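(* Let $k$ be a commutative associative unital ring and assume: (i) $A$ is a perfect $k$-algebra which is finitely presented as a $k$-module; (ii) $R$ is a commutative associative unital $k$-algebra which is flat over $k$; (iii) $S$ is a commutative associative unital $R$-algebra which is an étale covering of $R$, i.e. $S/R$ is étale and faithfully flat; (iv) $B\subset A_S=A\otimes_k S$ is an $(S/R)$-form of $A_R=A\otimes_k R$, i.e. $B$ is an $R$-subalgebra of $A_S$ such that $B\otimes_R S\to A_S$, $b\otimes s\mapsto sb$, is an isomorphism of $S$-algebras; (v) $N$ is a $(B,R)$-dimodule; (vi) there is an $R$-linear map $\pi: N_S=N\otimes_R S\to N$ with $\pi(b\cdot m)=b\cdot\pi(m)$ and $\pi(m\cdot b)=\pi(m)\cdot b$ for all $b\in B$, $m\in N_S$. Define $\rho:\operatorname{Hom}_k(A_S,N_S)\to\operatorname{Hom}_k(B,N)$ by $\rho(f)(b)=\pi(f(b))$. Let $\eta_S,\eta_B,\sigma_S,\varepsilon_N$ be the maps defined in the context. Then: (a) $\rho$ preserves derivations and centroidal transformations: $\rho(\operatorname{Der}_k(A_S,N_S))\subset\operatorname{Der}_k(B,N)$ and $\rho(\operatorname{Ctd}_k(A_S,N_S))\subset\operatorname{Ctd}_k(B,N)$. (b) The restriction of $\rho$ to $\operatorname{Ctd}_k(A_S,N_S)$ is an $R$-bimodule homomorphism: $\rho(r\cdot\chi)=r\cdot\rho(\chi)$ and $\rho(\chi\cdot r)=\rho(\chi)\cdot r$ for all $r\in R$, $\chi\in\operatorname{Ctd}_k(A_S,N_S)$. (c) The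 map $\tilde\rho:\operatorname{Der}_k(S,\operatorname{Ctd}_k(A_S,N_S))\to\operatorname{Der}_k(R,\operatorname{Ctd}_k(B,N))$, $\tilde\rho(d)(r)=\rho(d(r))$, is well-defined and satisfies $\eta_B\circ\rho\circ\sigma_S=\tilde\rho$. (d) The map $\sigma=\rho\circ\sigma_S\circ\varepsilon_N:\operatorname{Der}_k(R,\operatorname{Ctd}_k(B,N))\to\operatorname{Der}_k(B,N)$ is a section of $\eta_B$, i.e. $\eta_B\circ\sigma=\operatorname{Id}$; hence $$\operatorname{Der}_k(B,N)\simeq\operatorname{Der}_R(B,N)\oplus\operatorname{Der}_k(R,\operatorname{Ctd}_k(B,N)).$$ (e) In summary, there are two exact rows $$0\to\operatorname{Der}_S(A_S,N_S)\to\operatorname{Der}_k(A_S,N_S)\xrightarrow{\eta_S}\operatorname{Der}_k(S,\operatorname{Ctd}_k(A_S,N_S))\to 0,$$ $$0\to\operatorname{Der}_R(B,N)\to\operatorname{Der}_k(B,N)\xrightarrow{\eta_B}\operatorname{Der}_k(R,\operatorname{Ctd}_k(B,N)),$$ with $\sigma_S$ a section of $\eta_S$ and $\sigma$ a section of $\eta_B$, related by the maps $\rho:\operatorname{Der}_k(A_S,N_S)\to\operatorname{Der}_k(B,N)$, $\tilde\rho:\operatorname{Der}_k(S,\operatorname{Ctd}_k(A_S,N_S))\to\operatorname{Der}_k(R,\operatorname{Ctd}_k(B,N))$ and $\varepsilon_N$ in the direction opposite to $\tilde\rho$.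
   Context: Conventions. For a commutative associative unital ring $k$, a $k$-algebra is a $k$-module $A$ with a $k$-bilinear product (no associativity, unit or other identity assumed). $A$ is perfect if it is spanned additively by products $a_1a_2$. An $(A,k)$-dimodule is a $k$-module $M$ with two $k$-bilinear maps $A\times M\to M$, $(a,m)\mapsto a\cdot m$ and $M\times A\to M$, $(m,a)\mapsto m\cdot a$ (no compatibility required). Base change along a commutative ring extension $K/k$: $M_K=M\otimes_kK$ is an $(A_K,K)$-dimodule via $(a\otimes s_1)\cdot(m\otimes s_2)=(a\cdot m)\otimes s_1s_2$, $(m\otimes s_1)\cdot(a\otimes s_2)=(m\cdot a)\otimes s_1s_2$. Algebras and dimodules over $R$ or $S$ are viewed over $k$ by restriction of scalars. $\operatorname{Der}_k(A,M)$ is the $k$-module of $k$-linear $d:A\to M$ with $d(a_1a_2)=d(a_1)\cdot a_2+a_1\cdot d(a_2)$. $\operatorname{Ctd}_k(A,M)$ is the set of $k$-linear $\chi:A\to M$ with $\chi(a_1a_2)=\chi(a_1)\cdot a_2=a_1\cdot\chi(a_2)$ for all $a_1,a_2\in A$. If $B$ is an $R$-algebra and $N$ a $(B,R)$-dimodule, $\operatorname{Ctd}_k(B,N)$ is an $R$-bimodule via $(r\cdot\chi)(b)=r\chi(b)$, $(\chi\cdot r)(b)=\chi(rb)$ (the two structures coincide when $B$ is perfect), and $\operatorname{Der}_k(R,\operatorname{Ctd}_k(B,N))$ consists of $k$-linear $\delta$ with $\delta(r_1r_2)=\delta(r_1)\cdot r_2+r_1\cdot\delta(r_2)$. The same applies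 with $S$, $A_S$, $N_S$; $R$ acts on $\operatorname{Ctd}_k(A_S,N_S)$ through $R\to S$. Here $N_S=N\otimes_RS$ is an $(A_S,S)$-dimodule via the identification $A_S\simeq B_S=B\otimes_RS$. By faithful flatness $R\subset S$ and $N\subset N_S$ (via $n\mapsto n\otimes 1$). Maps. $\eta_B:\operatorname{Der}_k(B,N)\to\operatorname{Der}_k(R,\operatorname{Ctd}_k(B,N))$ is $(\eta_B(d)(r))(b)=d(rb)-rd(b)$; $\eta_S:\operatorname{Der}_k(A_S,N_S)\to\operatorname{Der}_k(S,\operatorname{Ctd}_k(A_S,N_S))$ is $(\eta_S(d)(s))(x)=d(sx)-sd(x)$. $\sigma_S:\operatorname{Der}_k(S,\operatorname{Ctd}_k(A_S,N_S))\to\operatorname{Der}_k(A_S,N_S)$ is $\sigma_S(d)(a\otimes s)=d(s)(a\otimes 1_S)$. For an $R$-module $P$ and $d\in\operatorname{Der}_k(R,P)$, since $S/R$ is étale there is a unique $k$-derivation $\varepsilon_P(d):S\to P_S=P\otimes_RS$ extending $d$ (i.e. $\varepsilon_P(d)(r)=d(r)\otimes 1$ for $r\in R$). The injective map $\varepsilon_N:\operatorname{Der}_k(R,\operatorname{Ctd}_k(B,N))\to\operatorname{Der}_k(S,\operatorname{Ctd}_k(A_S,N_S))$ is $\varepsilon_P$ for $P=\operatorname{Ctd}_k(B,N)$, followed by the canonical isomorphism $\operatorname{Ctd}_k(B,N)\otimes_RS=\operatorname{Ctd}_R(B,N)\otimes_RS\simeq\operatorname{Ctd}_S(B_S,N_S)\simeq\operatorname{Ctd}_k(A_S,N_S)$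 (which sends $\chi\otimes s$ to the $S$-linear map with $b\mapsto s\chi(b)$ for $b\in B$).
   Formalization: In (d), and for ''σ a section of η_B'' in (e), the formal statement additionally assumes π(n⊗1)=n for all n in N; without it the claim is false (k=ℚ, A=k, R=S=B=N=ℚ[x], π=0). *)

(* Defs.v *)
From HB Require Import structures.
From mathcomp Require Import all_boot all_algebra.
From mathcomp Require Import boolp functions.

Set Implicit Arguments.
Unset Strict Implicit.
Unset Printing Implicit Defensive.

Import GRing.Theory.
Local Open Scope ring_scope.
Local Open Scope quotient_scope.

(* Rings may be trivial (comPzRingType). A commutative K-algebra L is given by
   its structure morphism f : {rmorphism K -> L}. *)

Definition exact_at (U V W : zmodType) (u : U -> V) (v : V -> W) : Prop :=
  forall y, v y = 0 <-> exists x, u x = y.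

Definition restr (K L : comPzRingType) (f : {rmorphism K -> L})
  (V : lmodType L) : Type := V.

Section Restr.
Variables (K L : comPzRingType) (f : {rmorphism K -> L}) (V : lmodType L).

HB.instance Definition _ := GRing.Zmodule.on (restr f V).

Let rscale (c : K) (v : restr f V) : restr f V := f c *: (v : V).

Fact rscaleA a b v : rscale a (rscale b v) = rscale (a * b) v.
Proof. by rewrite /rscale scalerA rmorphM. Qed.
Fact rscale1 : left_id 1 rscale.
Proof. by move=> v; rewrite /rscale rmorph1 scale1r. Qed.
Fact rscaleDr : right_distributive rscale +%R.
Proof. by move=> a x y; rewrite /rscale scalerDr. Qed.
Fact rscaleDl v : {morph rscale^~ v : a b / a + b}.
Proof. by move=> a b; rewrite /rscale rmorphD scalerDl. Qed.

HB.instance Definition _ := GRing.Zmodule_isLmodule.Build K (restr f V)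
  rscaleA rscale1 rscaleDr rscaleDl.

Lemma restrZE (c : K) (v : restr f V) : c *: v = f c *: (v : V).
Proof. by []. Qed.

End Restr.

Definition klinear (K L : comPzRingType) (f : {rmorphism K -> L})
    (U V : lmodType L) (g : U -> V) : Prop :=
  forall (c : K) (x y : U), g (f c *: x + y) = f c *: g x + g y.

Record submod (K : comPzRingType) (V : lmodType K) := Submod {
  in_submod :> V -> Prop;
  submod0 : in_submod 0;
  submodP : forall c x y,
    in_submod x -> in_submod y -> in_submod (c *: x + y) }.

Record submod_of (K : comPzRingType) (V : lmodType K) (P : submod V) :=
  SubmodOf { submod_val :> V; _ : `[< P submod_val >] }.

Section SubmodType.
Variables (K : comPzRingType) (V : lmodType K) (P : submod V).

HB.instance Definition _ := [isSub for @submod_val K V P].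
HB.instance Definition _ := [Choice of submod_of P by <:].

Fact submod_closed_subproof : subsemimod_closed (fun x : V => `[< P x >]).
Proof.
have D x y : P x -> P y -> P (x + y).
  by move=> Px Py; rewrite -(scale1r x); apply: submodP.
split; first split.
- by apply/asboolP; apply: submod0.
- by move=> x y /asboolP Px /asboolP Py; apply/asboolP; apply: D.
- move=> c x /asboolP Px; apply/asboolP; rewrite -[c *: x]addr0.
  by apply: submodP => //; apply: submod0.
Qed.

HB.instance Definition _ := GRing.SubChoice_isSubLmodule.Build K V
  (fun x : V => `[< P x >]) (submod_of P) submod_closed_subproof.

Lemma submod_valP (x : submod_of P) : P (submod_val x).
Proof. by case: x => x /= /asboolP. Qed.

Definition to_submod (x : V) (Px : P x) : submod_of P := SubmodOf (asboolT Px).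

Lemma submod_inj (x y : submod_of P) : submod_val x = submod_val y -> x = y.
Proof. exact: val_inj. Qed.

End SubmodType.

Section BaseChange.
Variables (K L : comPzRingType) (f : {rmorphism K -> L}) (M : lmodType K).

(* M (x)_K L is the quotient of the lists of pairs (m, l), read as formal sums
   of the m (x) l, by the congruence generated by the tensor relations. *)
Inductive tens_eq : seq (M * L) -> seq (M * L) -> Prop :=
| tens_refl t : tens_eq t t
| tens_sym t u : tens_eq t u -> tens_eq u t
| tens_trans t u v : tens_eq t u -> tens_eq u v -> tens_eq t v
| tens_cat t t' u u' : tens_eq t t' -> tens_eq u u' ->
    tens_eq (t ++ u) (t' ++ u')
| tens_catC t u : tens_eq (t ++ u) (u ++ t)
| tens_00 : tens_eq [:: (0, 0)] [::]
| tens_Dl m m' l : tens_eq [:: (m + m', l)] [:: (m, l); (m', l)]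
| tens_Dr m l l' : tens_eq [:: (m, l + l')] [:: (m, l); (m, l')]
| tens_bal c m l : tens_eq [:: (c *: m, l)] [:: (m, f c * l)].

Definition tens_eqb (t u : seq (M * L)) : bool := `[< tens_eq t u >].

Fact tens_eqb_refl : reflexive tens_eqb.
Proof. by move=> t; apply/asboolP; apply: tens_refl. Qed.
Fact tens_eqb_sym : symmetric tens_eqb.
Proof.
by move=> t u; apply/asboolP/asboolP; apply: tens_sym.
Qed.
Fact tens_eqb_trans : transitive tens_eqb.
Proof.
by move=> u t v /asboolP H /asboolP H'; apply/asboolP; apply: tens_trans H H'.
Qed.

Definition tens_equiv : equiv_rel (seq (M * L)) :=
  EquivRel tens_eqb tens_eqb_refl tens_eqb_sym tens_eqb_trans.

Definition bchange : Type := {eq_quot tens_equiv}.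
HB.instance Definition _ := Choice.on bchange.

Definition bc_class (t : seq (M * L)) : bchange := \pi_{eq_quot tens_equiv} t.
Definition bc_repr (x : bchange) : seq (M * L) :=
  repr (x : {eq_quot tens_equiv}).

Lemma bc_reprK : cancel bc_repr bc_class.
Proof. by move=> x; rewrite /bc_class /bc_repr reprK. Qed.

Lemma bc_eqP t u : bc_class t = bc_class u <-> tens_eq t u.
Proof.
split=> [/eqquotP /asboolP //|H].
by apply/eqquotP; apply/asboolP.
Qed.

Lemma bc_repr_class t : tens_eq (bc_repr (bc_class t)) t.
Proof. by apply/bc_eqP; rewrite bc_reprK. Qed.

Definition bc_add (x y : bchange) := bc_class (bc_repr x ++ bc_repr y).
Definition bc_smul (l : L) (x : bchange) :=
  bc_class [seq (p.1, l * p.2) | p <- bc_repr x].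

Lemma bc_add_class t u : bc_add (bc_class t) (bc_class u) = bc_class (t ++ u).
Proof. by apply/bc_eqP; apply: tens_cat; apply: bc_repr_class. Qed.

Lemma tens_eq_scale l t u : tens_eq t u ->
  tens_eq [seq (p.1, l * p.2) | p <- t] [seq (p.1, l * p.2) | p <- u].
Proof.
elim=> {t u} /=.
- by move=> t; apply: tens_refl.
- by move=> t u _; apply: tens_sym.
- by move=> t u v _ H _; apply: tens_trans.
- by move=> t t' u u' _ H _ H'; rewrite !map_cat; apply: tens_cat.
- by move=> t u; rewrite !map_cat; apply: tens_catC.
- by rewrite mulr0; apply: tens_00.
- by move=> *; apply: tens_Dl.
- by move=> *; rewrite mulrDr; apply: tens_Dr.
- by move=> *; rewrite mulrCA; apply: tens_bal.
Qed.

Lemma bc_smul_class l t :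
  bc_smul l (bc_class t) = bc_class [seq (p.1, l * p.2) | p <- t].
Proof. by apply/bc_eqP; apply: tens_eq_scale; apply: bc_repr_class. Qed.

Lemma tens_0l l : tens_eq [:: (0, l)] [::].
Proof.
apply: tens_trans tens_00.
have := tens_bal 0 0 l; by rewrite scale0r rmorph0 mul0r.
Qed.

Lemma tens_0r m : tens_eq [:: (m, 0)] [::].
Proof.
apply: tens_trans (tens_0l 0).
have := tens_bal 0 m 0; rewrite scale0r mulr0; exact: tens_sym.
Qed.

Lemma bc_ind0 (x : bchange) : exists t, x = bc_class t.
Proof. by exists (bc_repr x); rewrite bc_reprK. Qed.

Fact bc_addA : associative bc_add.
Proof.
move=> x y z; have [t ->] := bc_ind0 x; have [u ->] := bc_ind0 y; have [v ->] := bc_ind0 z.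
by rewrite !bc_add_class catA.
Qed.
Fact bc_addC : commutative bc_add.
Proof.
move=> x y; have [t ->] := bc_ind0 x; have [u ->] := bc_ind0 y.
by rewrite !bc_add_class; apply/bc_eqP; apply: tens_catC.
Qed.
Fact bc_add0 : left_id (bc_class [::]) bc_add.
Proof. by move=> x; have [t ->] := bc_ind0 x; rewrite bc_add_class. Qed.
Fact bc_addN : left_inverse (bc_class [::]) (bc_smul (-1)) bc_add.
Proof.
move=> x; have [t ->] := bc_ind0 x; rewrite bc_smul_class bc_add_class.
apply/bc_eqP; elim: t => [|[m l] t IH] /=; first exact: tens_refl.
set t' := map _ _ in IH *.
apply: tens_trans IH; apply: (@tens_trans _ ([:: (m, -1 * l)] ++ [:: (m, l)] ++ (t' ++ t))).
  apply: (@tens_cat [:: _] [:: _]); first exact: tens_refl.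
  rewrite -cat1s !catA; apply: tens_cat; [exact: tens_catC|exact: tens_refl].
rewrite catA -[X in tens_eq _ X]cat0s; apply: tens_cat; last exact: tens_refl.
apply: tens_trans (tens_0r m); rewrite -(addNr l) mulN1r.
by apply: tens_sym; apply: tens_Dr.
Qed.

HB.instance Definition _ := GRing.isZmodule.Build bchange
  bc_addA bc_addC bc_add0 bc_addN.

Fact bc_smulA a b x : bc_smul a (bc_smul b x) = bc_smul (a * b) x.
Proof.
have [t ->] := bc_ind0 x; rewrite !bc_smul_class -map_comp.
by congr bc_class; apply: eq_map => p /=; rewrite mulrA.
Qed.
Fact bc_smul1 : left_id 1 bc_smul.
Proof.
move=> x; have [t ->] := bc_ind0 x; rewrite bc_smul_class.
by congr bc_class; rewrite -[RHS]map_id; apply: eq_map => -[m l] /=; rewrite mul1r.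
Qed.
Fact bc_smulDr : right_distributive bc_smul +%R.
Proof.
move=> a x y; have [t ->] := bc_ind0 x; have [u ->] := bc_ind0 y.
rewrite [_ + _]bc_add_class !bc_smul_class [RHS]bc_add_class map_cat //.
Qed.
Fact bc_smulDl x : {morph bc_smul^~ x : a b / a + b}.
Proof.
move=> a b; have [t ->] := bc_ind0 x.
rewrite /= !bc_smul_class [RHS]bc_add_class; apply/bc_eqP.
elim: t => [|[m l] t IH] /=; first exact: tens_refl.
rewrite mulrDl.
set ta := [seq (p.1, a * p.2) | p <- t] in IH *.
set tb := [seq (p.1, b * p.2) | p <- t] in IH *.
apply: (@tens_trans _ ([:: (m, a * l); (m, b * l)] ++ (ta ++ tb))).
  by apply: (@tens_cat [:: _] [:: _; _]) => //; exact: tens_Dr.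
apply: (@tens_cat [:: _] [:: _] ((m, b * l) :: _)); first exact: tens_refl.
rewrite -[X in tens_eq _ (_ ++ X)]cat1s -cat1s !catA.
by apply: tens_cat; [exact: tens_catC|exact: tens_refl].
Qed.

HB.instance Definition _ := GRing.Zmodule_isLmodule.Build L bchange
  bc_smulA bc_smul1 bc_smulDr bc_smulDl.

Definition tens (m : M) (l : L) : bchange := bc_class [:: (m, l)].

Lemma tensDl m m' l : tens (m + m') l = tens m l + tens m' l.
Proof. by rewrite [RHS]bc_add_class; apply/bc_eqP; apply: tens_Dl. Qed.
Lemma tensDr m l l' : tens m (l + l') = tens m l + tens m l'.
Proof. by rewrite [RHS]bc_add_class; apply/bc_eqP; apply: tens_Dr. Qed.
Lemma tensZl c m l : tens (c *: m) l = tens m (f c * l).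
Proof. by apply/bc_eqP; apply: tens_bal. Qed.
Lemma tensZr l m l' : l *: tens m l' = tens m (l * l').
Proof. exact: bc_smul_class. Qed.

Lemma tens_ind (P : bchange -> Prop) : P 0 ->
  (forall x y, P x -> P y -> P (x + y)) -> (forall m l, P (tens m l)) ->
  forall x, P x.
Proof.
move=> P0 PD Pt x; have [t ->] := bc_ind0 x.
elim: t => [|[m l] t IH]; first exact: P0.
have -> : bc_class ((m, l) :: t) = tens m l + bc_class t.
  by rewrite [RHS]bc_add_class.
exact: PD.
Qed.

Record balanced (V : zmodType) (b : M -> L -> V) : Prop := Balanced {
  balDl : forall m m' l, b (m + m') l = b m l + b m' l;
  balDr : forall m l l', b m (l + l') = b m l + b m l';
  balZ : forall c m l, b (c *: m) l = b m (f c * l) }.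

(* The additive map m (x) l |-> b m l; meaningful when b is balanced. *)
Definition bc_lift (V : zmodType) (b : M -> L -> V) (x : bchange) : V :=
  \sum_(p <- bc_repr x) b p.1 p.2.

Section Lift.
Variables (V : zmodType) (b : M -> L -> V) (bal : balanced b).

Lemma bc_lift_class t : bc_lift b (bc_class t) = \sum_(p <- t) b p.1 p.2.
Proof.
rewrite /bc_lift; move: (bc_repr_class t); move: (bc_repr _) => u.
elim=> {t u}.
- by [].
- by move=> t u _ ->.
- by move=> t u v _ -> _ ->.
- by move=> t t' u u' _ H _ H'; rewrite !big_cat H H'.
- by move=> t u; rewrite !big_cat /= addrC.
- rewrite big_seq1 big_nil /=; apply: (addrI (b 0 0)).
  by rewrite -(balDl bal) !addr0.
- by move=> *; rewrite !big_cons !big_nil !addr0 /= (balDl bal).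
- by move=> *; rewrite !big_cons !big_nil !addr0 /= (balDr bal).
- by move=> *; rewrite !big_seq1 /= (balZ bal).
Qed.

Lemma bc_lift_tens m l : bc_lift b (tens m l) = b m l.
Proof. by rewrite bc_lift_class big_seq1. Qed.

Lemma bc_liftD x y : bc_lift b (x + y) = bc_lift b x + bc_lift b y.
Proof.
have [t ->] := bc_ind0 x; have [u ->] := bc_ind0 y.
by rewrite [_ + _]bc_add_class !bc_lift_class big_cat.
Qed.

Lemma bc_lift0 : bc_lift b 0 = 0.
Proof. by apply: (addrI (bc_lift b 0)); rewrite -bc_liftD !addr0. Qed.

End Lift.

End BaseChange.

Arguments tens {K L} f {M} m l.

Lemma bc_map_balanced (K L : comPzRingType) (f : {rmorphism K -> L})
  (M M' : lmodType K) (g : {linear M -> M'}) :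
  balanced f (fun m l => tens f (g m) l).
Proof.
split=> [m m' l|m l l'|c m l].
- by rewrite linearD tensDl.
- exact: tensDr.
- by rewrite linearZ tensZl.
Qed.

Definition bc_map (K L : comPzRingType) (f : {rmorphism K -> L})
    (M M' : lmodType K) (g : {linear M -> M'}) : bchange f M -> bchange f M' :=
  bc_lift (fun m l => tens f (g m) l).

Arguments bc_map {K L} f {M M'} g _.

(* k^m --C--> k^n --a--> A --> 0 is exact. *)
Definition fin_pres_module (k : comPzRingType) (A : lmodType k) : Prop :=
  exists (n m : nat) (a : 'I_n -> A) (C : 'M[k]_(m, n)),
    (forall x, exists u : 'rV[k]_n, x = \sum_i u 0 i *: a i) /\
    (forall u : 'rV[k]_n,
       \sum_i u 0 i *: a i = 0 <-> exists v : 'rV[k]_m, u = v *m C).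

Definition flat (K L : comPzRingType) (f : {rmorphism K -> L}) : Prop :=
  forall (M1 M2 M3 : lmodType K) (u : {linear M1 -> M2}) (v : {linear M2 -> M3}),
    exact_at u v -> exact_at (bc_map f u) (bc_map f v).

Definition faithfully_flat (K L : comPzRingType) (f : {rmorphism K -> L}) :
    Prop :=
  forall (M1 M2 M3 : lmodType K) (u : {linear M1 -> M2}) (v : {linear M2 -> M3}),
    exact_at u v <-> exact_at (bc_map f u) (bc_map f v).

(* Polynomial expressions in n variables: {mpoly R[n]} would exclude the
   trivial ring. *)
Inductive pexpr (R : Type) (n : nat) :=
| PConst of R
| PVar of 'I_n
| PAdd of pexpr R n & pexpr R n
| PMul of pexpr R n & pexpr R n.

Fixpoint peval (R C : comPzRingType) (n : nat) (g : R -> C) (x : 'I_n -> C)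
    (e : pexpr R n) : C :=
  match e with
  | PConst r => g r
  | PVar i => x i
  | PAdd e1 e2 => peval g x e1 + peval g x e2
  | PMul e1 e2 => peval g x e1 * peval g x e2
  end.

(* S = R[X_1, ..., X_n] / (p_1, ..., p_m): the x_i generate S, satisfy the
   relations p_j, and S is universal for these two properties. *)
Definition fin_pres_algebra (R S : comPzRingType) (f : {rmorphism R -> S}) :
    Prop :=
  exists (n m : nat) (x : 'I_n -> S) (p : 'I_m -> pexpr R n),
    [/\ forall s, exists e, peval f x e = s,
        forall j, peval f x (p j) = 0
      & forall (C : comPzRingType) (g : {rmorphism R -> C}) (y : 'I_n -> C),
          (forall j, peval g y (p j) = 0) ->
          exists u : {rmorphism S -> C}, u \o f =1 g /\ u \o x =1 y].

Definition formally_etale (R S : comPzRingType) (f : {rmorphism R -> S}) :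
    Prop :=
  forall (C C' : comPzRingType) (q : {rmorphism C -> C'})
         (g : {rmorphism R -> C}) (u : {rmorphism S -> C'}),
    (forall y, exists x, q x = y) ->
    (forall x y, q x = 0 -> q y = 0 -> x * y = 0) ->
    u \o f =1 q \o g ->
    (exists v : {rmorphism S -> C}, v \o f =1 g /\ q \o v =1 u) /\
    (forall v w : {rmorphism S -> C},
       v \o f =1 g /\ q \o v =1 u -> w \o f =1 g /\ q \o w =1 u -> v =1 w).

Definition etale (R S : comPzRingType) (f : {rmorphism R -> S}) : Prop :=
  fin_pres_algebra f /\ formally_etale f.

Record nalg (k : comPzRingType) := Nalg {
  nalg_mod :> lmodType k;
  nmul : nalg_mod -> nalg_mod -> nalg_mod;
  nmul_linl : forall b, linear (nmul^~ b);
  nmul_linr : forall a, linear (nmul a) }.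

Arguments nmul {k n} _ _.

Definition perfect (k : comPzRingType) (A : nalg k) : Prop :=
  forall x : A, exists t : seq (A * A), x = \sum_(p <- t) nmul p.1 p.2.

Record dimod (k : comPzRingType) (A : nalg k) := Dimod {
  dimod_mod :> lmodType k;
  lact : A -> dimod_mod -> dimod_mod;
  ract : dimod_mod -> A -> dimod_mod;
  lact_linl : forall m, linear (lact^~ m);
  lact_linr : forall a, linear (lact a);
  ract_linl : forall a, linear (ract^~ a);
  ract_linr : forall m, linear (ract m) }.

Arguments lact {k A} d _ _.
Arguments ract {k A} d _ _.

Section LinearFacts.
Variables (K : comPzRingType) (U V : lmodType K) (g : U -> V).
Hypothesis lg : linear g.
Lemma lin_D x y : g (x + y) = g x + g y.
Proof. by have := lg 1 x y; rewrite !scale1r. Qed.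
Lemma lin_0 : g 0 = 0.
Proof. by apply: (addrI (g 0)); rewrite -lin_D !addr0. Qed.
Lemma lin_Z c x : g (c *: x) = c *: g x.
Proof. by have := lg c x 0; rewrite !addr0 lin_0 addr0. Qed.
End LinearFacts.

Section BaseChangeBilinear.
Variables (K L : comPzRingType) (f : {rmorphism K -> L}).
Variables (U V W : lmodType K) (mu : U -> V -> W).
Hypothesis mul1 : forall v, linear (mu^~ v).
Hypothesis mul2 : forall u, linear (mu u).

Definition bc_bilin (x : bchange f U) (y : bchange f V) : bchange f W :=
  bc_lift (fun u s => bc_lift (fun v t => tens f (mu u v) (s * t)) y) x.

Lemma bc_bilin_bal u s : balanced f (fun v t => tens f (mu u v) (s * t)).
Proof.
split=> [v v' t|v t t'|c v t].
- by rewrite (lin_D (mul2 u)) tensDl.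
- by rewrite mulrDr tensDr.
- by rewrite (lin_Z (mul2 u)) tensZl mulrCA.
Qed.

Lemma bc_bilin_bal' (y : bchange f V) :
  balanced f (fun u s => bc_lift (fun v t => tens f (mu u v) (s * t)) y).
Proof.
split=> [u u' s|u s s'|c u s]; elim/tens_ind: y => [|y z|v t].
all: rewrite ?(bc_lift0 (bc_bilin_bal _ _)) ?addr0 //.
all: rewrite ?(bc_liftD (bc_bilin_bal _ _)) ?(bc_lift_tens (bc_bilin_bal _ _)).
- by move=> -> ->; rewrite addrACA.
- by rewrite (lin_D (mul1 v)) tensDl.
- by move=> -> ->; rewrite addrACA.
- by rewrite mulrDl tensDr.
- by move=> -> ->.
- by rewrite (lin_Z (mul1 v)) tensZl mulrA.
Qed.

Lemma bc_bilin_tens u s v t :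
  bc_bilin (tens f u s) (tens f v t) = tens f (mu u v) (s * t).
Proof.
by rewrite /bc_bilin (bc_lift_tens (bc_bilin_bal' _))
  (bc_lift_tens (bc_bilin_bal _ _)).
Qed.

Lemma bc_bilinDl x x' y : bc_bilin (x + x') y = bc_bilin x y + bc_bilin x' y.
Proof. exact: (bc_liftD (bc_bilin_bal' y)). Qed.

Lemma bc_bilin0l y : bc_bilin 0 y = 0.
Proof. exact: (bc_lift0 (bc_bilin_bal' y)). Qed.

Lemma bc_bilinDr x y y' : bc_bilin x (y + y') = bc_bilin x y + bc_bilin x y'.
Proof.
elim/tens_ind: x => [|x x'|u s]; first by rewrite !bc_bilin0l addr0.
  by rewrite !bc_bilinDl => -> ->; rewrite addrACA.
rewrite /bc_bilin !(bc_lift_tens (bc_bilin_bal' _)).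
by rewrite (bc_liftD (bc_bilin_bal _ _)).
Qed.

Lemma bc_bilin0r x : bc_bilin x 0 = 0.
Proof. by apply: (addrI (bc_bilin x 0)); rewrite -bc_bilinDr !addr0. Qed.

Lemma bc_bilinZl c x y : bc_bilin (c *: x) y = c *: bc_bilin x y.
Proof.
elim/tens_ind: x => [|x x' Hx Hx'|u s].
- by rewrite scaler0 !bc_bilin0l scaler0.
- by rewrite scalerDr !bc_bilinDl Hx Hx' scalerDr.
elim/tens_ind: y => [|y y' Hy Hy'|v t].
- by rewrite !bc_bilin0r scaler0.
- by rewrite !bc_bilinDr Hy Hy' scalerDr.
by rewrite tensZr !bc_bilin_tens tensZr mulrA.
Qed.

Lemma bc_bilinZr c x y : bc_bilin x (c *: y) = c *: bc_bilin x y.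
Proof.
elim/tens_ind: x => [|x x' Hx Hx'|u s].
- by rewrite !bc_bilin0l scaler0.
- by rewrite !bc_bilinDl Hx Hx' scalerDr.
elim/tens_ind: y => [|y y' Hy Hy'|v t].
- by rewrite scaler0 !bc_bilin0r scaler0.
- by rewrite scalerDr !bc_bilinDr Hy Hy' scalerDr.
by rewrite tensZr !bc_bilin_tens tensZr mulrCA.
Qed.

Lemma bc_bilin_linl y : linear (bc_bilin^~ y).
Proof. by move=> c x x'; rewrite /= bc_bilinDl bc_bilinZl. Qed.
Lemma bc_bilin_linr x : linear (bc_bilin x).
Proof. by move=> c y y'; rewrite bc_bilinDr bc_bilinZr. Qed.

End BaseChangeBilinear.

Definition bc_alg (K L : comPzRingType) (f : {rmorphism K -> L}) (A : nalg K) :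
    nalg L :=
  @Nalg L (bchange f A) (bc_bilin (@nmul K A))
    (bc_bilin_linl (@nmul_linl K A) (@nmul_linr K A))
    (bc_bilin_linr (@nmul_linl K A) (@nmul_linr K A)).

Definition bc_dimod (K L : comPzRingType) (f : {rmorphism K -> L}) (A : nalg K)
    (M : dimod A) : dimod (bc_alg f A) :=
  @Dimod L (bc_alg f A) (bchange f M) (bc_bilin (lact M)) (bc_bilin (ract M))
    (bc_bilin_linl (@lact_linl _ _ M) (@lact_linr _ _ M))
    (bc_bilin_linr (@lact_linl _ _ M) (@lact_linr _ _ M))
    (bc_bilin_linl (@ract_linl _ _ M) (@ract_linr _ _ M))
    (bc_bilin_linr (@ract_linl _ _ M) (@ract_linr _ _ M)).

(* B is an R-algebra and N a (B,R)-dimodule, both viewed over k through h. *)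

Section DerCtd.
Variables (k R : comPzRingType) (h : {rmorphism k -> R}).
Variables (B : nalg R) (N : dimod B).

Lemma klin_D (U V : lmodType R) (g : U -> V) (lg : klinear h g) x y :
  g (x + y) = g x + g y.
Proof. by have := lg 1 x y; rewrite rmorph1 !scale1r. Qed.
Lemma klin_0 (U V : lmodType R) (g : U -> V) (lg : klinear h g) : g 0 = 0.
Proof. by apply: (addrI (g 0)); rewrite -(klin_D lg) !addr0. Qed.
Lemma klin_Z (U V : lmodType R) (g : U -> V) (lg : klinear h g) c x :
  g (h c *: x) = h c *: g x.
Proof. by have := lg c x 0; rewrite !addr0 (klin_0 lg) addr0. Qed.

Definition is_der (d : B -> N) : Prop :=
  klinear h d /\
  forall a b, d (nmul a b) = ract N (d a) b + lact N a (d b).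

Definition is_ctd (chi : B -> N) : Prop :=
  klinear h chi /\
  forall a b, chi (nmul a b) = ract N (chi a) b /\
              chi (nmul a b) = lact N a (chi b).

Lemma klin0 (U V : lmodType R) : klinear h (0 : U -> V).
Proof. by move=> c x y; rewrite scaler0 addr0. Qed.

Lemma klinP (U V : lmodType R) (r : R) (g g' : U -> V) :
  klinear h g -> klinear h g' -> klinear h (r *: g + g').
Proof.
move=> lg lg' c x y.
have E z : (r *: g + g') z = r *: g z + g' z by [].
by rewrite !E lg lg' !scalerDr addrACA !scalerA (mulrC r).
Qed.

Fact der0 : is_der (0 : B -> N).
Proof.
split=> [|a b]; first exact: klin0.
by rewrite (lin_0 (ract_linl _)) (lin_0 (lact_linr _)) addr0.
Qed.

Fact derP (c : R) (d d' : B -> N) :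
  is_der d -> is_der d' -> is_der (c *: d + d').
Proof.
move=> [l m] [l' m']; split=> [|a b]; first exact: klinP.
have E z : (c *: d + d') z = c *: d z + d' z by [].
by rewrite !E m m' (ract_linl b) (lact_linr a) scalerDr addrACA.
Qed.

(* Der_k(B,N), a k-module. *)
Definition der_submod : submod (restr h (B -> N)) :=
  @Submod k (restr h (B -> N)) is_der der0 (fun c => @derP (h c)).

Definition Der : lmodType k := submod_of der_submod.
Definition der_fun (d : Der) : B -> N := submod_val d.
Lemma der_funP (d : Der) : is_der (der_fun d).
Proof. exact: submod_valP d. Qed.
Definition mk_der (d : B -> N) (Hd : is_der d) : Der :=
  @to_submod _ _ der_submod d Hd.

Fact ctd0 : is_ctd (0 : B -> N).
Proof.
split=> [|a b]; first exact: klin0.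
by rewrite (lin_0 (ract_linl _)) (lin_0 (lact_linr _)).
Qed.

Fact ctdP (c : R) (d d' : B -> N) :
  is_ctd d -> is_ctd d' -> is_ctd (c *: d + d').
Proof.
move=> [l m] [l' m']; split=> [|a b]; first exact: klinP.
have E z : (c *: d + d') z = c *: d z + d' z by [].
rewrite !E (ract_linl b) (lact_linr a).
by have [<- <-] := m a b; have [<- <-] := m' a b.
Qed.

(* Ctd_k(B,N), an R-module for (r . chi)(b) = r chi(b). *)
Definition ctd_submod : submod (B -> N) := Submod ctd0 ctdP.

Definition Ctd : lmodType R := submod_of ctd_submod.
Definition ctd_fun (chi : Ctd) : B -> N := submod_val chi.
Lemma ctd_funP (chi : Ctd) : is_ctd (ctd_fun chi).
Proof. exact: submod_valP chi. Qed.
Definition mk_ctd (chi : B -> N) (Hchi : is_ctd chi) : Ctd :=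
  @to_submod _ _ ctd_submod chi Hchi.

Lemma ctd_ext (chi chi' : Ctd) : ctd_fun chi =1 ctd_fun chi' -> chi = chi'.
Proof. by move=> E; apply: submod_inj; apply: funext. Qed.

Fact ctd_ract_subproof (chi : Ctd) (r : R) :
  is_ctd (fun b => ctd_fun chi (r *: b)).
Proof.
have [l m] := ctd_funP chi; split=> [c x y|a b].
  by rewrite scalerDr scalerA mulrC -scalerA l.
split.
- by rewrite -(lin_Z (nmul_linl b)) (m _ _).1.
- by rewrite -(lin_Z (nmul_linr a)) (m _ _).2.
Qed.

Definition ctd_ract (chi : Ctd) (r : R) : Ctd := mk_ctd (ctd_ract_subproof chi r).

(* k-linear derivations of R with values in the R-bimodule Ctd_k(B,N). *)
Definition is_derctd (delta : R -> Ctd) : Prop :=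
  klinear h (delta : R^o -> Ctd) /\
  forall r1 r2, delta (r1 * r2) = ctd_ract (delta r1) r2 + r1 *: delta r2.

Lemma ctd_ractDl (chi chi' : Ctd) r :
  ctd_ract (chi + chi') r = ctd_ract chi r + ctd_ract chi' r.
Proof. by apply: ctd_ext. Qed.
Lemma ctd_ractZl c (chi : Ctd) r :
  ctd_ract (c *: chi) r = c *: ctd_ract chi r.
Proof. by apply: ctd_ext. Qed.

Fact derctd0 : is_derctd (0 : R -> Ctd).
Proof.
split=> [|r1 r2]; first exact: klin0.
apply: ctd_ext => b; rewrite scaler0 addr0 //.
Qed.

Fact derctdP (c : k) (d d' : restr h (R -> Ctd)) :
  is_derctd d -> is_derctd d' -> is_derctd (c *: d + d').
Proof.
move=> [l m] [l' m']; split=> [|r1 r2].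
  exact: (@klinP R^o Ctd (h c) d d' l l').
have E z : (c *: d + d') z = h c *: d z + d' z by [].
rewrite !E m m' ctd_ractDl ctd_ractZl !scalerDr addrACA !scalerA.
by rewrite (mulrC (h c)).
Qed.

Definition derctd_submod : submod (restr h (R -> Ctd)) :=
  @Submod k (restr h (R -> Ctd)) is_derctd derctd0 derctdP.

(* Der_k(R, Ctd_k(B,N)), a k-module. *)
Definition DerCtd : lmodType k := submod_of derctd_submod.
Definition derctd_fun (delta : DerCtd) : R -> Ctd := submod_val delta.
Lemma derctd_funP (delta : DerCtd) : is_derctd (derctd_fun delta).
Proof. exact: submod_valP delta. Qed.
Definition mk_derctd (delta : R -> Ctd) (Hdelta : is_derctd delta) : DerCtd :=
  @to_submod _ _ derctd_submod delta Hdelta.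

Lemma ctd_fun_lin c (chi chi' : Ctd) b :
  ctd_fun (c *: chi + chi') b = c *: ctd_fun chi b + ctd_fun chi' b.
Proof. by []. Qed.
Lemma derctd_fun_lin c (d d' : DerCtd) r :
  derctd_fun (c *: d + d') r = h c *: derctd_fun d r + derctd_fun d' r.
Proof. by []. Qed.

Lemma derctd_ext (d d' : DerCtd) :
  (forall r b, ctd_fun (derctd_fun d r) b = ctd_fun (derctd_fun d' r) b) ->
  d = d'.
Proof.
by move=> E; apply: submod_inj; apply: funext => r; apply: ctd_ext.
Qed.

Fact eta_ctd (d : Der) (r : R) :
  is_ctd (fun b => der_fun d (r *: b) - r *: der_fun d b).
Proof.
have [l m] := der_funP d; split=> [c x y|a b].
  have -> : r *: (h c *: x + y) = h c *: (r *: x) + r *: y.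
    by rewrite scalerDr !scalerA mulrC.
  by rewrite !l scalerDr scalerBr !scalerA opprD (mulrC r) addrACA.
split.
- rewrite -(lin_Z (nmul_linl b)) !m (lin_Z (lact_linl _)) scalerDr.
  rewrite opprD addrACA subrr addr0 (lin_D (ract_linl b)).
  by rewrite -scaleN1r (lin_Z (ract_linl b)) scaleN1r (lin_Z (ract_linl b)).
- rewrite -(lin_Z (nmul_linr a)) !m (lin_Z (ract_linr _)) scalerDr.
  rewrite opprD addrACA subrr add0r (lin_D (lact_linr a)).
  by rewrite -scaleN1r (lin_Z (lact_linr a)) scaleN1r (lin_Z (lact_linr a)).
Qed.

Fact eta_derctd (d : Der) : is_derctd (fun r => mk_ctd (eta_ctd d r)).
Proof.
have [l m] := der_funP d; split=> [c r1 r2|r1 r2]; apply: ctd_ext => b.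
  change (der_fun d ((h c * r1 + r2) *: b) - (h c * r1 + r2) *: der_fun d b =
    h c *: (der_fun d (r1 *: b) - r1 *: der_fun d b) +
    (der_fun d (r2 *: b) - r2 *: der_fun d b)).
  rewrite !scalerDl -!scalerA l scalerBr !scalerA opprD addrACA //.
change (der_fun d ((r1 * r2) *: b) - (r1 * r2) *: der_fun d b =
  (der_fun d (r1 *: (r2 *: b)) - r1 *: der_fun d (r2 *: b)) +
  r1 *: (der_fun d (r2 *: b) - r2 *: der_fun d b)).
by rewrite !scalerA scalerBr scalerA addrA subrK.
Qed.

Definition eta (d : Der) : DerCtd := mk_derctd (eta_derctd d).

Fact eta_linear : linear eta.
Proof.
move=> c d d'; apply: derctd_ext => r b.
change ((h c *: der_fun d (r *: b) + der_fun d' (r *: b)) -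
   r *: (h c *: der_fun d b + der_fun d' b) =
   h c *: (der_fun d (r *: b) - r *: der_fun d b) +
   (der_fun d' (r *: b) - r *: der_fun d' b)).
by rewrite scalerDr opprD addrACA scalerBr !scalerA (mulrC r).
Qed.
HB.instance Definition _ := GRing.isLinear.Build k Der DerCtd _ eta eta_linear.

End DerCtd.

Arguments Der {k R} h B N.
Arguments Ctd {k R} h B N.
Arguments DerCtd {k R} h B N.
Arguments eta {k R} h {B N} _.
Arguments der_fun {k R h B N} _ _.
Arguments ctd_fun {k R h B N} _ _.
Arguments derctd_fun {k R h B N} _ _.

Section DerIncl.
Variables (k R : comPzRingType) (h : {rmorphism k -> R}).
Variables (B : nalg R) (N : dimod B).

(* Der_R(B,N), viewed as a k-module. *)
Definition DerR : lmodType k := restr h (Der (@idfun R) B N).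

Fact der_incl_subproof (d : DerR) : is_der h (@der_fun _ _ (@idfun R) B N d).
Proof.
by have [l m] := der_funP (d : Der (@idfun R) B N); split=> // c; apply: l.
Qed.

Definition der_incl (d : DerR) : Der h B N := mk_der (der_incl_subproof d).

Fact der_incl_linear : linear der_incl.
Proof. by move=> c d d'; apply: submod_inj. Qed.
HB.instance Definition _ :=
  GRing.isLinear.Build k DerR (Der h B N) _ der_incl der_incl_linear.

End DerIncl.

Arguments DerR {k R} h B N.

Section SigmaS.
Variables (k S : comPzRingType) (fh : {rmorphism k -> S}) (A : nalg k).
Variable (M : dimod (bc_alg fh A)).
Local Notation AS := (bc_alg fh A).

Definition sigmaS_fun (d : DerCtd fh AS M) : AS -> M :=
  bc_lift (fun a s => ctd_fun (derctd_fun d s) (tens fh a 1)).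

Lemma sigmaS_bal (d : DerCtd fh AS M) :
  balanced fh (fun a s => ctd_fun (derctd_fun d s) (tens fh a 1)).
Proof.
have [l m] := derctd_funP d.
have lc s : klinear fh (ctd_fun (derctd_fun d s)).
  by have [] := ctd_funP (derctd_fun d s).
split=> [a a' s|a s s'|c a s].
- by rewrite tensDl (klin_D (lc s)).
- by rewrite (klin_D l).
- rewrite (klin_Z l c s) tensZl mulr1 -[fh c as X in tens _ _ X]mulr1 -tensZr.
  exact: (klin_Z (lc s)).
Qed.

Lemma sigmaS_funD (d : DerCtd fh AS M) x y :
  sigmaS_fun d (x + y) = sigmaS_fun d x + sigmaS_fun d y.
Proof. exact: (bc_liftD (sigmaS_bal d)). Qed.

Lemma sigmaS_fun0 (d : DerCtd fh AS M) : sigmaS_fun d 0 = 0.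
Proof. exact: (bc_lift0 (sigmaS_bal d)). Qed.

Lemma sigmaS_fun_tens (d : DerCtd fh AS M) a s :
  sigmaS_fun d (tens fh a s) = ctd_fun (derctd_fun d s) (tens fh a 1).
Proof. exact: (bc_lift_tens (sigmaS_bal d)). Qed.

Fact sigmaS_subproof (d : DerCtd fh AS M) : is_der fh (sigmaS_fun d).
Proof.
have [l m] := derctd_funP d.
have lc s : klinear fh (ctd_fun (derctd_fun d s)).
  by have [] := ctd_funP (derctd_fun d s).
have lD := sigmaS_funD d; have l0 := sigmaS_fun0 d.
have lt := sigmaS_fun_tens d.
split=> [c x y|x y].
  rewrite lD; congr (_ + _).
  elim/tens_ind: x => [|x x' Hx Hx'|a s].
  - by rewrite scaler0 l0 scaler0.
  - by rewrite scalerDr !lD Hx Hx' scalerDr.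
  - by rewrite tensZr !lt (klin_Z l c s).
elim/tens_ind: x => [|x x' Hx Hx'|a s].
- rewrite (lin_0 (nmul_linl y)) l0.
  by rewrite (lin_0 (ract_linl y)) (lin_0 (lact_linl _)) addr0.
- rewrite (lin_D (nmul_linl y)) !lD Hx Hx'.
  by rewrite (lin_D (ract_linl y)) (lin_D (lact_linl _)) addrACA.
elim/tens_ind: y => [|y y' Hy Hy'|b t].
- rewrite (lin_0 (nmul_linr _)) l0.
  by rewrite (lin_0 (ract_linr _)) (lin_0 (lact_linr _)) addr0.
- rewrite (lin_D (nmul_linr _)) !lD Hy Hy'.
  by rewrite (lin_D (ract_linr _)) (lin_D (lact_linr _)) addrACA.
have E u v z w : @nmul S AS (tens fh u z) (tens fh v w) = tens fh (nmul u v) (z * w).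
  exact: (bc_bilin_tens fh (@nmul_linl k A) (@nmul_linr k A)).
rewrite E !lt m.
have -> : ctd_fun (ctd_ract (derctd_fun d s) t + s *: derctd_fun d t)
    (tens fh (nmul a b) 1) =
  ctd_fun (derctd_fun d s) (t *: tens fh (nmul a b) 1) +
  s *: ctd_fun (derctd_fun d t) (tens fh (nmul a b) 1) by [].
have [_ cs] := ctd_funP (derctd_fun d s).
have [_ ct] := ctd_funP (derctd_fun d t).
have -> : t *: tens fh (nmul a b) 1 = @nmul S AS (tens fh a 1) (tens fh b t).
  by rewrite E tensZr mul1r mulr1.
rewrite (cs _ _).1; congr (_ + _).
have -> : tens fh (nmul a b) 1 = @nmul S AS (tens fh a 1) (tens fh b 1).
  by rewrite E mulr1.
by rewrite (ct _ _).2 -(lin_Z (lact_linl _)) tensZr mulr1.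
Qed.

Definition sigmaS (d : DerCtd fh AS M) : Der fh AS M := mk_der (sigmaS_subproof d).

Fact sigmaS_linear : linear sigmaS.
Proof.
move=> c d d'; apply: submod_inj; apply: funext => x.
change (sigmaS_fun (c *: d + d') x = fh c *: sigmaS_fun d x + sigmaS_fun d' x).
elim/tens_ind: x => [|x x' Hx Hx'|a s].
- by rewrite !sigmaS_fun0 scaler0 addr0.
- by rewrite !sigmaS_funD Hx Hx' !scalerDr addrACA.
- by rewrite !sigmaS_fun_tens derctd_fun_lin ctd_fun_lin.
Qed.
HB.instance Definition _ := GRing.isLinear.Build k
  (DerCtd fh AS M) (Der fh AS M) _ sigmaS sigmaS_linear.

End SigmaS.

Section Form.
Variables (k R S : comPzRingType).
Variables (h : {rmorphism k -> R}) (f : {rmorphism R -> S}) (A : nalg k).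
Local Notation AS := (bc_alg (f \o h) A).

Definition form_map (B : submod (restr f AS)) : bchange f (submod_of B) -> AS :=
  bc_lift (fun (b : submod_of B) (s : S) => s *: (submod_val b : AS)).

(* form_map is automatically S-linear and multiplicative when B is closed under
   products, so it is an isomorphism of S-algebras iff it is bijective. *)
Record SRform := SRForm {
  form_submod : submod (restr f AS);
  form_mul_closed : forall x y : AS,
    form_submod x -> form_submod y -> form_submod (nmul x y);
  form_map_bij : bijective (@form_map form_submod) }.

Variable B : SRform.

Definition form_mod : lmodType R := submod_of (form_submod B).
Definition form_val (b : form_mod) : AS := submod_val b.

Definition form_mul (x y : form_mod) : form_mod :=
  to_submod (form_mul_closed (submod_valP x) (submod_valP y)).

Fact form_mul_linl y : linear (form_mul^~ y).
Proof.
move=> c x x'; apply: submod_inj.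
exact: (nmul_linl (form_val y) (f c) (form_val x) (form_val x')).
Qed.
Fact form_mul_linr x : linear (form_mul x).
Proof.
move=> c y y'; apply: submod_inj.
exact: (nmul_linr (form_val x) (f c) (form_val y) (form_val y')).
Qed.

Definition form_alg : nalg R := Nalg form_mul_linl form_mul_linr.

Fact form_inv_ex : exists g, cancel (@form_map (form_submod B)) g /\
                             cancel g (@form_map (form_submod B)).
Proof. by have [g] := form_map_bij B; exists g. Qed.

Definition form_inv : AS -> bchange f form_alg := projT1 (cid form_inv_ex).
Lemma form_mapK : cancel (@form_map (form_submod B)) form_inv.
Proof. by rewrite /form_inv; case: (cid _) => g []. Qed.
Lemma form_invK : cancel form_inv (@form_map (form_submod B)).
Proof. by rewrite /form_inv; case: (cid _) => g []. Qed.

Lemma form_map_bal :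
  balanced f (fun (b : form_mod) (s : S) => s *: (form_val b : AS)).
Proof.
split=> [b b' s|b s s'|c b s].
- exact: scalerDr.
- exact: scalerDl.
- have -> : form_val (c *: b) = f c *: form_val b by [].
  by rewrite scalerA mulrC.
Qed.

Lemma form_map_linear : linear (@form_map (form_submod B)).
Proof.
move=> c x y; rewrite /form_map (bc_liftD form_map_bal); congr (_ + _).
elim/tens_ind: x => [|x x' Hx Hx'|b s].
- by rewrite scaler0 !(bc_lift0 form_map_bal) scaler0.
- by rewrite scalerDr !(bc_liftD form_map_bal) Hx Hx' scalerDr.
- by rewrite tensZr !(bc_lift_tens form_map_bal) scalerA.
Qed.

Lemma form_inv_linear : linear form_inv.
Proof.
move=> c x y; rewrite -{1}(form_invK x) -{1}(form_invK y).
by rewrite -form_map_linear form_mapK.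
Qed.

Variable N : dimod form_alg.

Fact formS_linear1 (P : lmodType S) (mu : bchange f form_alg -> bchange f N -> P) :
  (forall m, linear (mu^~ m)) -> forall m, linear (fun x => mu (form_inv x) m).
Proof. by move=> H m c x y; rewrite form_inv_linear (H m). Qed.

Fact formS_linear2 (P : lmodType S) (mu : bchange f N -> bchange f form_alg -> P) :
  (forall m, linear (mu m)) -> forall m, linear (fun x => mu m (form_inv x)).
Proof. by move=> H m c x y; rewrite form_inv_linear (H m). Qed.

(* N_S = N (x)_R S, on which A_S acts through A_S ~ B (x)_R S. *)
Definition formS_dimod : dimod AS :=
  let NS := bc_dimod f N in
  @Dimod S AS (bchange f N)
    (fun x m => lact NS (form_inv x) m) (fun m x => ract NS m (form_inv x))
    (formS_linear1 (@lact_linl _ _ NS)) (fun x => @lact_linr _ _ NS (form_inv x))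
    (fun x => @ract_linl _ _ NS (form_inv x)) (formS_linear2 (@ract_linr _ _ NS)).

Definition rho (pi : {linear restr f formS_dimod -> N})
    (F : AS -> formS_dimod) : form_alg -> N :=
  fun b => pi (F (form_val b)).

Local Notation ASN := (Ctd (f \o h) AS formS_dimod).
Local Notation BN := (Ctd h form_alg N).

(* D : S -> P_S, P an R-module, is a k-derivation extending d : R -> P. *)
Definition extends_der (P : lmodType R) (d : R -> P) (D : S -> bchange f P) :
    Prop :=
  [/\ klinear (f \o h) (D : S^o -> bchange f P),
      forall s t, D (s * t) = t *: D s + s *: D t
    & forall r, D (f r) = tens f (d r) 1].

(* c is the canonical map Ctd_k(B,N) (x)_R S -> Ctd_k(A_S,N_S) sending
   chi (x) s to the S-linear map with b |-> s chi(b) on B. *)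
Definition is_canonical (c : {linear bchange f BN -> ASN}) : Prop :=
  forall (chi : BN) (s : S),
    linear (ctd_fun (c (tens f chi s))) /\
    forall b, ctd_fun (c (tens f chi s)) (form_val b) =
              s *: tens f (ctd_fun chi b) 1.

(* The graph of epsilon_N: delta' is epsilon_P(delta), P = Ctd_k(B,N), followed
   by the canonical map. *)
Definition is_epsN (delta : DerCtd h form_alg N)
    (delta' : DerCtd (f \o h) AS formS_dimod) : Prop :=
  exists (D : S -> bchange f BN) (c : {linear bchange f BN -> ASN}),
    [/\ extends_der (derctd_fun delta) D, is_canonical c
      & forall s, derctd_fun delta' s = c (D s)].

End Form.

(* Main.v *)
From HB Require Import structures.
Require Import Defs.
From mathcomp Require Import all_boot all_algebra.
From mathcomp Require Import boolp functions.

(** The map rho evaluates on B and then applies pi, which is R-linear and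
    commutes with the actions of B.  So rho carries identities between maps on
    A_S that involve only elements of B and scalars of R to the same identities
    on B: derivations go to derivations, centroidal transformations to
    centroidal transformations, and eta_B o rho = rho~ o eta_S (eta_rhoD).

    Over A_S = A (x)_k S the coefficient ring S splits off, so sigma_S is a
    section of eta_S by a direct computation on tensors (eta_sigmaS); hence
    eta_B o rho o sigma_S = rho~.

    If moreover pi retracts n |-> n (x) 1, then rho~ o epsilon_N = id
    (rhoT_epsN): epsilon_N(delta) restricted to R and to B is delta followed by
    n |-> n (x) 1, and pi undoes that inclusion.  The two identities give the
    section rho o sigma_S o epsilon_N of eta_B, and a section of the last map of
    a left exact sequence splits it (split_exact).  The kernel of eta consists
    of the derivations that commute with scalars, so both rows are exact
    (eta_exact).

    What remains is the existence, uniqueness and linearity of epsilon_N.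

    - Extending a derivation d : R -> P to S -> P_S amounts to lifting the
      identity of S along the square-zero extension S (+) P_S -> S in a way
      compatible with r |-> (r, d r (x) 1); since S/R is formally etale, there
      is exactly one such lift (etale_deriv_exists, etale_deriv_unique).

    - B is perfect: B^2 -> B becomes surjective after the faithfully flat base
      change to S, because A_S is perfect (form_perfect).  Over a perfect
      algebra every centroidal transformation is linear over the whole
      coefficient ring (ctd_perfect_linear).  Thus chi in Ctd_k(B,N) has an
      S-linear extension chi (x) id : B_S -> N_S, which provides the canonical
      map Ctd_k(B,N) (x)_R S -> Ctd_k(A_S,N_S) (canonical_exists); it is unique
      because B spans A_S over S (canonical_unique). *)

Set Implicit Arguments.
Unset Strict Implicit.
Unset Printing Implicit Defensive.

Import GRing.Theory.
Local Open Scope ring_scope.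

(** * Split exact sequences *)

(** Bundles maps whose linearity is a theorem about their construction, such as
    epsilon_N, which is picked by choice and linear by uniqueness. *)
Lemma linear_exists (K : comPzRingType) (U V : lmodType K) (g : U -> V) :
  linear g -> exists G : {linear U -> V}, G =1 g.
Proof.
move=> lg; pose gL := GRing.isLinear.Build K U V *:%R g lg.
by exists (HB.pack_for {linear U -> V} g gL).
Qed.

(** The inverse of (u, w) |-> i u + s w sends v to the preimage under i of
    v - s (p v), which lies in the kernel of p, paired with p v. *)
Lemma split_exact (K : comPzRingType) (U V W : lmodType K)
    (i : {linear U -> V}) (p : {linear V -> W}) (s : {linear W -> V}) :
  injective i -> exact_at i p -> cancel s p ->
  exists Phi : {linear (U * W)%type -> V},
    (forall u w, Phi (u, w) = i u + s w) /\ bijective Phi.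
Proof.
move=> i_inj ip sK.
have pi0 u : p (i u) = 0 by apply/ip; exists u.
have [|Phi PhiE] := @linear_exists K (U * W)%type V (fun x => i x.1 + s x.2).
  move=> c [u w] [u' w'] /=.
  by rewrite !linearP scalerDr addrACA.
exists Phi; split=> [u w|]; first by rewrite PhiE.
have ker v : exists u, i u = v - s (p v).
  by apply/ip; rewrite linearB /= sK subrr.
pose r v := projT1 (cid (ker v)).
have rE v : i (r v) = v - s (p v) by rewrite /r; case: cid.
exists (fun v => (r v, p v)) => [[u w]|v]; rewrite !PhiE /=; last first.
  by rewrite rE subrK.
have pE : p (i u + s w) = w by rewrite linearD /= pi0 add0r sK.
by rewrite pE; congr (_, _); apply: i_inj; rewrite rE pE addrK.
Qed.

(** * Derivations as homomorphisms to square-zero extensions *)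

Section SquareZero.
Variables (L : comPzRingType) (P : lmodType L).

(** The ring L (+) P in which P is an ideal of square zero; an alias keeps its
    product apart from the componentwise structure of pairs. *)
Definition sqzero : Type := (L * P)%type.
HB.instance Definition _ := GRing.Zmodule.on sqzero.

Definition sqzero_mul (x y : sqzero) : sqzero :=
  (x.1 * y.1, y.1 *: x.2 + x.1 *: y.2).

Fact sqzero_mulA : associative sqzero_mul.
Proof.
move=> [a x] [b y] [c z]; congr (_, _) => /=; first exact: mulrA.
by rewrite !scalerDr !scalerA addrA (mulrC b c) (mulrC c a).
Qed.
Fact sqzero_mulC : commutative sqzero_mul.
Proof.
by move=> [a x] [b y]; congr (_, _) => /=; [apply: mulrC|rewrite addrC].
Qed.
Fact sqzero_mul1 : left_id (1, 0) sqzero_mul.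
Proof.
by move=> [a x]; congr (_, _) => /=; rewrite ?mul1r ?scaler0 ?add0r ?scale1r.
Qed.
Fact sqzero_mulDl : left_distributive sqzero_mul +%R.
Proof.
move=> [a x] [b y] [c z]; congr (_, _) => /=; first exact: mulrDl.
by rewrite scalerDr scalerDl addrACA.
Qed.

HB.instance Definition _ := GRing.Zmodule_isComPzRing.Build sqzero
  sqzero_mulA sqzero_mulC sqzero_mul1 sqzero_mulDl.

Definition sqzero_proj (x : sqzero) : L := x.1.
Fact sqzero_proj_additive : zmod_morphism sqzero_proj.
Proof. by []. Qed.
Fact sqzero_proj_multiplicative : monoid_morphism sqzero_proj.
Proof. by []. Qed.
HB.instance Definition _ :=
  GRing.isZmodMorphism.Build sqzero L sqzero_proj sqzero_proj_additive.
HB.instance Definition _ :=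
  GRing.isMonoidMorphism.Build sqzero L sqzero_proj sqzero_proj_multiplicative.

(** Derivations of R into P, seen as an R-module through f. *)
Definition deriv_along (R : comPzRingType) (f : R -> L) (d : R -> P) : Prop :=
  {morph d : a b / a + b} /\
  forall a b, d (a * b) = f b *: d a + f a *: d b.

Lemma deriv_along1 (R : comPzRingType) (f : {rmorphism R -> L}) d :
  deriv_along f d -> d 1 = 0.
Proof.
move=> [_ dM]; have := dM 1 1; rewrite rmorph1 !mulr1 scale1r.
by move/(congr1 (fun y => y - d 1)); rewrite subrr addrK.
Qed.

(** The Leibniz rule says precisely that r |-> (f r, d r) is multiplicative. *)
Lemma deriv_rmorphism (R : comPzRingType) (f : {rmorphism R -> L}) d :
  deriv_along f d ->
  exists g : {rmorphism R -> sqzero}, forall r, g r = (f r, d r).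
Proof.
move=> Hd; have [dD dM] := Hd.
have d0 : d 0 = 0 by apply: (addrI (d 0)); rewrite -dD !addr0.
have dN a : d (- a) = - d a.
  by apply: (addrI (d a)); rewrite -dD !subrr.
pose g r : sqzero := (f r, d r).
have gB : zmod_morphism g.
  by move=> a b; congr (_, _); rewrite ?rmorphB ?dD ?dN.
have gM : monoid_morphism g.
  split; first by congr (_, _); rewrite ?rmorph1 ?(deriv_along1 Hd).
  by move=> a b; congr (_, _); rewrite ?rmorphM ?dM.
pose m1 := GRing.isZmodMorphism.Build R sqzero g gB.
pose m2 := GRing.isMonoidMorphism.Build R sqzero g gM.
by exists (HB.pack_for {rmorphism R -> sqzero} g m1 m2).
Qed.

End SquareZero.

(** * Derivations along an etale homomorphism *)

Section EtaleDerivation.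
Variables (R S : comPzRingType) (f : {rmorphism R -> S}) (P : lmodType S).

(** The second component of a ring map that lifts the identity of S and extends
    r |-> (f r, d r) is the required derivation. *)
Lemma etale_deriv_exists (d : R -> P) :
  formally_etale f -> deriv_along f d ->
  exists2 D : S -> P, deriv_along idfun D & forall r, D (f r) = d r.
Proof.
move=> fet /deriv_rmorphism[g gE].
have [|||[v [vf vq]] _] := fet _ _ (@sqzero_proj S P) g idfun.
- by move=> s; exists (s, 0).
- move=> [a x] [b y]; rewrite /sqzero_proj /= => -> ->.
  by congr (_, _) => /=; rewrite ?mulr0 ?scale0r ?addr0.
- by move=> r; rewrite /= gE.
have vE s : (v s).1 = s by exact: vq.
exists (fun s => (v s).2).
  split=> [s t|s t]; first by rewrite rmorphD.
  by rewrite rmorphM /= !vE.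
by move=> r; have /= -> := vf r; rewrite gE.
Qed.

(** Both derivations give lifts of the identity of S along sqzero_proj that
    agree on R; formal etaleness leaves room for one only. *)
Lemma etale_deriv_unique (D D' : S -> P) :
  formally_etale f -> deriv_along idfun D -> deriv_along idfun D' ->
  (forall r, D (f r) = D' (f r)) -> D =1 D'.
Proof.
move=> fet HD HD' DD' s.
have [v vE] := @deriv_rmorphism S P S idfun D HD.
have [w wE] := @deriv_rmorphism S P S idfun D' HD'.
have [|||_ U] := fet _ _ (@sqzero_proj S P) (v \o f) idfun.
- by move=> t; exists (t, 0).
- move=> [a x] [b y]; rewrite /sqzero_proj /= => -> ->.
  by congr (_, _) => /=; rewrite ?mulr0 ?scale0r ?addr0.
- by move=> r; rewrite /= vE.
have : v s = w s.
  apply: U; split=> r //=; rewrite ?vE ?wE //.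
  by rewrite DD'.
by rewrite vE wE => -[].
Qed.

End EtaleDerivation.

(** * Perfect algebras *)

Definition sum_of_products (K : comPzRingType) (A : nalg K) (x : A) : Prop :=
  exists t : seq (A * A), x = \sum_(p <- t) nmul p.1 p.2.

Lemma sum_of_products0 (K : comPzRingType) (A : nalg K) :
  sum_of_products (0 : A).
Proof. by exists [::]; rewrite big_nil. Qed.

Lemma sum_of_productsP (K : comPzRingType) (A : nalg K) (c : K) (x y : A) :
  sum_of_products x -> sum_of_products y -> sum_of_products (c *: x + y).
Proof.
move=> [t ->] [u ->]; exists ([seq (c *: p.1, p.2) | p <- t] ++ u).
rewrite big_cat big_map scaler_sumr; congr (_ + _).
by apply: eq_bigr => p _; rewrite (lin_Z (nmul_linl _)).
Qed.

Definition square_submod (K : comPzRingType) (A : nalg K) : submod A :=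
  Submod (@sum_of_products0 K A) (@sum_of_productsP K A).

Lemma bchange_perfect (K L : comPzRingType) (f : {rmorphism K -> L})
  (A : nalg K) : perfect A -> perfect (bc_alg f A).
Proof.
move=> Aperf x; rewrite -/(sum_of_products x).
elim/tens_ind: x => [|x y Px Py|a s].
- exact: sum_of_products0.
- by rewrite -[x]scale1r; apply: sum_of_productsP.
have [t ->] := Aperf a.
elim: t => [|p t IH]; rewrite ?big_nil ?big_cons.
  by exists [::]; rewrite big_nil; apply/bc_eqP; apply: tens_0l.
rewrite tensDl -[X in sum_of_products (X + _)]scale1r.
apply: sum_of_productsP => //.
exists [:: (tens f p.1 s, tens f p.2 1)]; rewrite big_seq1 /=.
by rewrite (bc_bilin_tens f (@nmul_linl K A) (@nmul_linr K A)) mulr1.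
Qed.

(** Surjectivity of g is exactness of U -> V -> 0; taking the zero endomorphism
    of V as second map keeps the sequence inside the given modules. *)
Lemma faithfully_flat_surjective (R S : comPzRingType) (f : {rmorphism R -> S})
    (U V : lmodType R) (g : {linear U -> V}) :
  faithfully_flat f -> (forall y, exists x, bc_map f g x = y) ->
  forall y, exists x, g x = y.
Proof.
move=> ff gS; pose z : {linear V -> V} := \0.
have zE x : bc_map f z x = 0.
  elim/tens_ind: x => [|x y Hx Hy|v s].
  - exact: (bc_lift0 (bc_map_balanced f z)).
  - rewrite /bc_map (bc_liftD (bc_map_balanced f z)) -/(bc_map f z).
    by rewrite Hx Hy addr0.
  - rewrite /bc_map (bc_lift_tens (bc_map_balanced f z)).
    by apply/bc_eqP; apply: tens_0l.
have /ff ex : exact_at (bc_map f g) (bc_map f z) by move=> y; split.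
by move=> y; apply/ex.
Qed.

Lemma submod_val_linear (K : comPzRingType) (V : lmodType K) (P : submod V) :
  linear (@submod_val K V P).
Proof. by []. Qed.

(** On a product, chi (r (a b)) = chi ((r a) b) = (r a) chi b = r (a chi b)
    = r chi (a b), and products span B. *)
Lemma ctd_perfect_linear (k R : comPzRingType) (h : {rmorphism k -> R})
    (B : nalg R) (N : dimod B) (chi : Ctd h B N) :
  perfect B -> linear (ctd_fun chi).
Proof.
move=> Bperf; have [l m] := ctd_funP chi.
move=> r x y; rewrite (klin_D l); congr (_ + _).
have [t ->] := Bperf x.
elim: t => [|p t IH]; rewrite ?big_nil ?big_cons.
  by rewrite scaler0 (klin_0 l) scaler0.
rewrite scalerDr !(klin_D l) IH scalerDr; congr (_ + _).
by rewrite -(lin_Z (nmul_linl _)) !(m _ _).2 (lin_Z (lact_linl _)).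
Qed.

Lemma ctd_ract_perfect (k R : comPzRingType) (h : {rmorphism k -> R})
    (B : nalg R) (N : dimod B) (chi : Ctd h B N) r :
  perfect B -> ctd_ract chi r = r *: chi.
Proof.
move=> Bperf; apply: ctd_ext => b.
exact: (lin_Z (ctd_perfect_linear chi Bperf)).
Qed.

(** * Forms *)

Section Form.
Variables (k R S : comPzRingType).
Variables (h : {rmorphism k -> R}) (f : {rmorphism R -> S}) (A : nalg k).
Variable B : SRform h f A.
Local Notation AS := (bc_alg (f \o h) A).

(** B spans A_S over S; this reduces identities on A_S to multiples of elements
    of B. *)
Lemma form_span (P : AS -> Prop) :
  P 0 -> (forall x y, P x -> P y -> P (x + y)) ->
  (forall s (b : form_alg B), P (s *: (form_val b : AS))) -> forall x, P x.
Proof.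
move=> P0 PD Pb x; rewrite -(form_invK B x).
elim/tens_ind: (form_inv B x) => [|y z Py Pz|b s].
- by rewrite (lin_0 (@form_map_linear _ _ _ _ _ _ B)).
- by rewrite (lin_D (@form_map_linear _ _ _ _ _ _ B)); apply/PD.
- by rewrite /form_map (bc_lift_tens (form_map_bal B)); apply: Pb.
Qed.

Lemma form_inv_scale s (b : form_alg B) :
  form_inv B (s *: (form_val b : AS)) = tens f b s.
Proof.
rewrite -[RHS](@form_mapK _ _ _ _ _ _ B _) /form_map.
by rewrite (bc_lift_tens (form_map_bal B)).
Qed.

Lemma form_mul_scale s t (b b' : form_alg B) :
  @nmul S AS (s *: (form_val b : AS)) (t *: (form_val b' : AS)) =
  (s * t) *: (form_val (nmul b b') : AS).
Proof.
by rewrite (lin_Z (@nmul_linl S AS _)) (lin_Z (@nmul_linr S AS _)) scalerA.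
Qed.

Lemma linear_form_ext (M : lmodType S) (F G : AS -> M) :
  linear F -> linear G ->
  (forall b : form_alg B, F (form_val b) = G (form_val b)) -> F =1 G.
Proof.
move=> lF lG E; apply: form_span => [|x y Ex Ey|s b].
- by rewrite (lin_0 lF) (lin_0 lG).
- by rewrite (lin_D lF) (lin_D lG) Ex Ey.
- by rewrite (lin_Z lF) (lin_Z lG) E.
Qed.

(** A_S is perfect and spanned over S by B, and a product of multiples of b and
    b' is a multiple of b b'.  So A_S = B (x)_R S is the image of B^2 (x)_R S, and
    faithfully flat descent gives B = B^2. *)
Lemma form_perfect :
  perfect A -> faithfully_flat f -> perfect (form_alg B).
Proof.
move=> Aperf ff b.
pose P := square_submod (form_alg B).
have [g gE] := linear_exists (@submod_val_linear R (form_alg B) P).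
suff [x <-] : exists x, g x = b by rewrite gE; apply: (submod_valP x).
apply: (faithfully_flat_surjective ff) => {b} y.
have gbal := bc_map_balanced f g.
rewrite -(@form_mapK _ _ _ _ _ _ B y); move: (form_map y) => x {y}.
have li := form_inv_linear B.
have im0 : exists z, bc_map f g z = form_inv B 0.
  by exists 0; rewrite (lin_0 li) /bc_map (bc_lift0 gbal).
have imD u v : (exists z, bc_map f g z = form_inv B u) ->
    (exists z, bc_map f g z = form_inv B v) ->
    exists z, bc_map f g z = form_inv B (u + v).
  move=> [z Hz] [w Hw]; exists (z + w).
  by rewrite (lin_D li) /bc_map (bc_liftD gbal) -/(bc_map f g) Hz Hw.
have [t ->] := @bchange_perfect _ _ (f \o h) A Aperf x.
elim: t => [|[u v] t IH]; rewrite ?big_nil ?big_cons //.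
apply/imD => //.
change (exists z, bc_map f g z = form_inv B (@nmul S AS u v)).
elim/form_span: u => [|u u' Hu Hu'|s b].
- by rewrite (lin_0 (@nmul_linl S AS _)).
- by rewrite (lin_D (@nmul_linl S AS _)); apply/imD.
elim/form_span: v => [|v v' Hv Hv'|s' b'].
- by rewrite (lin_0 (@nmul_linr S AS _)).
- by rewrite (lin_D (@nmul_linr S AS _)); apply/imD.
rewrite form_mul_scale form_inv_scale.
have Pbb : P (nmul b b') by exists [:: (b, b')]; rewrite big_seq1.
exists (tens f (to_submod Pbb) (s * s')).
by rewrite /bc_map (bc_lift_tens gbal) gE.
Qed.

Variable N : dimod (form_alg B).
Local Notation NS := (formS_dimod N).
Local Notation ASN := (Ctd (f \o h) AS NS).
Local Notation BN := (Ctd h (form_alg B) N).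

(** chi (x) id, transported along A_S ~ B (x)_R S. *)
Definition ctdS_fun (chi : BN) (x : AS) : NS :=
  bc_lift (fun b s => tens f (ctd_fun chi b) s) (form_inv B x).

Section PerfectForm.
Context (Bperf : perfect (form_alg B)).

(** Compatibility with the tensor relation over R needs chi to be R-linear,
    which is where perfectness of B enters. *)
Lemma ctdS_bal (chi : BN) :
  balanced f (fun (b : form_alg B) s => tens f (ctd_fun chi b) s).
Proof.
have l := ctd_perfect_linear chi Bperf.
split=> [b b' s|b s s'|r b s].
- by rewrite (lin_D l) tensDl.
- exact: tensDr.
- by rewrite (lin_Z l) tensZl.
Qed.

Lemma ctdS_fun_scale (chi : BN) s (b : form_alg B) :
  ctdS_fun chi (s *: (form_val b : AS)) = tens f (ctd_fun chi b) s.
Proof. by rewrite /ctdS_fun form_inv_scale (bc_lift_tens (ctdS_bal chi)). Qed.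

Lemma ctdS_fun_linear (chi : BN) : linear (ctdS_fun chi).
Proof.
have bal := ctdS_bal chi; have li := form_inv_linear B.
have lD x y : ctdS_fun chi (x + y) = ctdS_fun chi x + ctdS_fun chi y.
  by rewrite /ctdS_fun (lin_D li) (bc_liftD bal).
have l0 : ctdS_fun chi 0 = 0 by rewrite /ctdS_fun (lin_0 li) (bc_lift0 bal).
move=> c x y; rewrite lD; congr (_ + _).
elim/form_span: x => [|x x' Hx Hx'|s b].
- by rewrite scaler0 l0 scaler0.
- by rewrite scalerDr !lD Hx Hx' scalerDr.
- by rewrite scalerA !ctdS_fun_scale tensZr.
Qed.

Lemma ctdS_is_ctd (chi : BN) : is_ctd (f \o h) (ctdS_fun chi).
Proof.
have l := ctdS_fun_linear chi; have [_ m] := ctd_funP chi.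
have lF := lact_linl (d := NS); have lG := lact_linr (d := NS).
have rF := ract_linl (d := NS); have rG := ract_linr (d := NS).
split=> [c x y|x y]; first exact: l.
elim/form_span: x => [|x x' [Hx1 Hx2] [Hx1' Hx2']|s b].
- rewrite (lin_0 (@nmul_linl S AS y)) (lin_0 l).
  by rewrite (lin_0 (rF y)) (lin_0 (lF _)).
- rewrite (lin_D (@nmul_linl S AS y)) !(lin_D l).
  rewrite (lin_D (rF y)) (lin_D (lF _)).
  by split; [rewrite Hx1 Hx1'|rewrite Hx2 Hx2'].
elim/form_span: y => [|y y' [Hy1 Hy2] [Hy1' Hy2']|t b'].
- rewrite (lin_0 (@nmul_linr S AS _)) (lin_0 l).
  by rewrite (lin_0 (rG _)) (lin_0 (lG _)).
- rewrite (lin_D (@nmul_linr S AS _)) !(lin_D l).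
  rewrite (lin_D (rG _)) (lin_D (lG _)).
  by split; [rewrite Hy1 Hy1'|rewrite Hy2 Hy2'].
rewrite form_mul_scale !ctdS_fun_scale /= !form_inv_scale.
rewrite (bc_bilin_tens f (@lact_linl _ _ N) (@lact_linr _ _ N)).
rewrite (bc_bilin_tens f (@ract_linl _ _ N) (@ract_linr _ _ N)).
by have [<- <-] := m b b'.
Qed.

Definition ctdS (chi : BN) : ASN := mk_ctd (ctdS_is_ctd chi).

Lemma ctdS_bal2 : balanced f (fun chi s => s *: ctdS chi).
Proof.
have E s chi x : ctd_fun (s *: ctdS chi) x = s *: ctdS_fun chi x by [].
have ED (chi chi' : ASN) x :
  ctd_fun (chi + chi') x = ctd_fun chi x + ctd_fun chi' x by [].
split=> [chi chi' s|chi s s'|r chi s]; last 1 first.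
- apply: ctd_ext => x; rewrite !E.
  elim/form_span: x => [|x y Hx Hy|t b].
  + by rewrite !(lin_0 (ctdS_fun_linear _)) !scaler0.
  + by rewrite !(lin_D (ctdS_fun_linear _)) !scalerDr Hx Hy.
  + have EZ : ctd_fun (r *: chi) b = r *: ctd_fun chi b by [].
    by rewrite !ctdS_fun_scale EZ tensZl !tensZr mulrCA mulrA.
- apply: ctd_ext => x; rewrite ED !E.
  elim/form_span: x => [|x y Hx Hy|t b].
  + by rewrite !(lin_0 (ctdS_fun_linear _)) !scaler0 addr0.
  + by rewrite !(lin_D (ctdS_fun_linear _)) !scalerDr Hx Hy addrACA.
  + by rewrite !ctdS_fun_scale -scalerDr -tensDl.
- exact: scalerDl.
Qed.

Lemma canonical_exists :
  exists c : {linear bchange f BN -> ASN}, is_canonical c.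
Proof.
have bal := ctdS_bal2.
have [|c cE] := @linear_exists S (bchange f BN) ASN
  (bc_lift (fun chi s => s *: ctdS chi)).
  move=> s x y; rewrite (bc_liftD bal); congr (_ + _).
  elim/tens_ind: x => [|x x' Hx Hx'|chi t].
  - by rewrite scaler0 (bc_lift0 bal) scaler0.
  - by rewrite scalerDr !(bc_liftD bal) Hx Hx' scalerDr.
  - by rewrite tensZr !(bc_lift_tens bal) scalerA.
exists c => chi s.
have E x : ctd_fun (c (tens f chi s)) x = s *: ctdS_fun chi x.
  by rewrite cE (bc_lift_tens bal).
split=> [t x y|b].
  by rewrite !E ctdS_fun_linear scalerDr !scalerA mulrC.
by rewrite E -[form_val b]scale1r ctdS_fun_scale.
Qed.

End PerfectForm.

(** The images of the pure tensors are S-linear and prescribed on B, which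
    spans A_S. *)
Lemma canonical_unique (c c' : {linear bchange f BN -> ASN}) :
  is_canonical c -> is_canonical c' -> c =1 c'.
Proof.
move=> Hc Hc' x; elim/tens_ind: x => [|x y Hx Hy|chi s].
- by rewrite !linear0.
- by rewrite !linearD Hx Hy.
apply: ctd_ext.
have [lc E] := Hc chi s; have [lc' E'] := Hc' chi s.
by apply: (linear_form_ext lc lc') => b; rewrite E E'.
Qed.

End Form.

(** * The extension map epsilon_N *)

Section ExtendsDer.
Variables (k R S : comPzRingType).
Variables (h : {rmorphism k -> R}) (f : {rmorphism R -> S}) (P : lmodType R).

Lemma extends_der_deriv (d : R -> P) (D : S -> bchange f P) :
  extends_der h d D -> deriv_along idfun D.
Proof. by case=> lD mD _; split=> [x y|//]; apply: (klin_D lD). Qed.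

Lemma extends_der_unique (d : R -> P) (D D' : S -> bchange f P) :
  formally_etale f -> extends_der h d D -> extends_der h d D' -> D =1 D'.
Proof.
move=> fet HD HD'; apply: (etale_deriv_unique fet).
- exact: extends_der_deriv HD.
- exact: extends_der_deriv HD'.
- by move=> r; have [_ _ ->] := HD; have [_ _ ->] := HD'.
Qed.

Lemma extends_der_exists (d : R -> P) :
  formally_etale f -> klinear h (d : R^o -> P) ->
  (forall r r', d (r * r') = r' *: d r + r *: d r') ->
  exists D : S -> bchange f P, extends_der h d D.
Proof.
move=> fet ld md.
have Hd : deriv_along (@idfun R) d by split=> // r r'; apply: (klin_D ld).
(* Formal etaleness only yields an additive D with the Leibniz rule; such a D is
   k-linear because d, hence D, kills the image of k. *)
have dh c : d (h c) = 0.
  have := klin_Z ld c 1; rewrite (deriv_along1 Hd) scaler0.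
  by rewrite -[h c *: _]/(h c * 1) mulr1.
pose d1 r := tens f (d r) 1.
have Hd1 : deriv_along f d1.
  split=> [r r'|r r']; rewrite /d1.
    by rewrite (klin_D ld) tensDl.
  by rewrite md tensDl !tensZl !tensZr.
have [D HD DE] := etale_deriv_exists fet Hd1; have [DD DM] := HD.
exists D; split=> // c x y; rewrite DD; congr (_ + _).
have -> : (f \o h) c *: x = (f \o h) c * x :> S by [].
have Dc : D ((f \o h) c) = 0.
  by rewrite DE /d1 dh; apply/bc_eqP; apply: tens_0l.
by rewrite DM Dc scaler0 add0r.
Qed.

End ExtendsDer.

Section Epsilon.
Variables (k R S : comPzRingType).
Variables (h : {rmorphism k -> R}) (f : {rmorphism R -> S}).
Variables (A : nalg k) (B : SRform h f A) (N : dimod (form_alg B)).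
Local Notation AS := (bc_alg (f \o h) A).
Local Notation NS := (formS_dimod N).

Lemma is_epsN_unique (delta : DerCtd h (form_alg B) N)
    (delta1 delta2 : DerCtd (f \o h) AS NS) :
  formally_etale f -> is_epsN delta delta1 -> is_epsN delta delta2 ->
  delta1 = delta2.
Proof.
move=> fet [D [c [HD Hc E]]] [D' [c' [HD' Hc' E']]].
apply: derctd_ext => s x; rewrite E E'.
by rewrite (extends_der_unique fet HD HD') (canonical_unique Hc Hc').
Qed.

(** Composing the extension D : S -> Ctd_k(B,N) (x)_R S with the canonical map
    gives a derivation in the bimodule sense because A_S is perfect, so that
    both actions of S on Ctd_k(A_S,N_S) agree. *)
Lemma is_epsN_exists (delta : DerCtd h (form_alg B) N) :
  perfect A -> perfect (form_alg B) -> formally_etale f ->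
  exists delta', is_epsN delta delta'.
Proof.
move=> Aperf Bperf fet; have [c Hc] := canonical_exists N Bperf.
have [l m] := derctd_funP delta.
have [|D HD] := extends_der_exists fet l.
  by move=> r r'; rewrite m ctd_ract_perfect.
have [lD mD _] := HD.
have Hder : @is_derctd _ _ (f \o h) AS NS (c \o D).
  split=> [a s t|s t] /=; first by rewrite lD linearP.
  rewrite mD linearD !linearZ /= ctd_ract_perfect //.
  exact: bchange_perfect.
by exists (mk_derctd Hder); exists D, c.
Qed.

(** Linearity of epsilon_N: a combination of extensions is an extension of the
    combination, and both can use the same canonical map by uniqueness. *)
Lemma is_epsNP c (delta1 delta2 : DerCtd h (form_alg B) N) delta1' delta2' :
  is_epsN delta1 delta1' -> is_epsN delta2 delta2' ->
  is_epsN (c *: delta1 + delta2) (c *: delta1' + delta2').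
Proof.
move=> [D1 [i1 [[l1 m1 e1] H1 E1]]] [D2 [i2 [[l2 m2 e2] H2 E2]]].
exists (fun s => f (h c) *: D1 s + D2 s), i1; split=> //; last first.
  move=> s; rewrite derctd_fun_lin E1 E2 linearP.
  by rewrite (canonical_unique H2 H1).
split=> [a x y|s t|r].
- by rewrite l1 l2 !scalerDr !scalerA addrACA (mulrC (f (h c))).
- rewrite m1 m2 !scalerDr !scalerA !(mulrC (f (h c))) addrACA //.
- by rewrite e1 e2 derctd_fun_lin tensDl tensZl tensZr.
Qed.

Lemma epsN_exists :
  perfect A -> perfect (form_alg B) -> formally_etale f ->
  exists epsN : {linear DerCtd h (form_alg B) N -> DerCtd (f \o h) AS NS},
    forall delta delta', is_epsN delta delta' <-> delta' = epsN delta.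
Proof.
move=> Aperf Bperf fet.
pose e delta := projT1 (cid (is_epsN_exists delta Aperf Bperf fet)).
have eP delta : is_epsN delta (e delta) by rewrite /e; case: cid.
have [|epsN epsNE] := @linear_exists _ _ _ e.
  move=> c d1 d2; apply: (is_epsN_unique fet (eP _)).
  exact: is_epsNP.
exists epsN => delta delta'; rewrite epsNE; split=> [H|->]; last exact: eP.
exact: is_epsN_unique fet H (eP _).
Qed.

End Epsilon.

(** * The sequence of a derivation module *)

Section DerFun.
Variables (k R : comPzRingType) (h : {rmorphism k -> R}).
Variables (B : nalg R) (N : dimod B).

Lemma der_ext (d d' : Der h B N) : der_fun d =1 der_fun d' -> d = d'.
Proof. by move=> E; apply: submod_inj; apply: funext. Qed.

Lemma der_fun_lin c (d d' : Der h B N) b :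
  der_fun (c *: d + d') b = h c *: der_fun d b + der_fun d' b.
Proof. by []. Qed.

Lemma eta_fun (d : Der h B N) r b :
  ctd_fun (derctd_fun (eta h d) r) b = der_fun d (r *: b) - r *: der_fun d b.
Proof. by []. Qed.

End DerFun.

Lemma der_incl_injective (k R : comPzRingType) (h : {rmorphism k -> R})
    (B : nalg R) (N : dimod B) : injective (@der_incl k R h B N).
Proof. by move=> d d' /(congr1 der_fun) E; apply: submod_inj. Qed.

(** eta d vanishes exactly when d commutes with all scalars of R. *)
Lemma eta_exact (k R : comPzRingType) (h : {rmorphism k -> R})
    (B : nalg R) (N : dimod B) :
  exact_at (@der_incl k R h B N) (eta h).
Proof.
move=> d; split=> [d0|[e <-]].
  have [l m] := der_funP d.
  have Hd : @is_der _ _ (@idfun R) B N (der_fun d).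
    split=> // r x y /=; rewrite (klin_D l); congr (_ + _).
    apply/eqP; rewrite -subr_eq0; apply/eqP.
    exact: (congr1 (fun e => ctd_fun (derctd_fun e r) x) d0).
  by exists (mk_der Hd : DerR h B N); apply: submod_inj.
apply: derctd_ext => r b.
have [l m] := der_funP (e : Der (@idfun R) B N).
change (der_fun (e : Der (@idfun R) B N) (r *: b) -
  r *: der_fun (e : Der (@idfun R) B N) b = 0).
by rewrite (klin_Z l r) subrr.
Qed.

(** On a (x) t, the Leibniz rule for delta (s t) leaves
    delta(s) (t (a (x) 1)) = delta(s) (a (x) t). *)
Lemma eta_sigmaS (k S : comPzRingType) (h : {rmorphism k -> S}) (A : nalg k)
    (M : dimod (bc_alg h A)) (delta : DerCtd h (bc_alg h A) M) :
  eta h (sigmaS delta) = delta.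
Proof.
have [l m] := derctd_funP delta.
apply: derctd_ext => s x.
change (sigmaS_fun delta (s *: x) - s *: sigmaS_fun delta x =
  ctd_fun (derctd_fun delta s) x).
have [lc _] := ctd_funP (derctd_fun delta s).
elim/tens_ind: x => [|x y Hx Hy|a t].
- by rewrite scaler0 sigmaS_fun0 scaler0 subrr (klin_0 lc).
- by rewrite scalerDr !sigmaS_funD (klin_D lc) -Hx -Hy scalerDr opprD addrACA.
rewrite tensZr !sigmaS_fun_tens m.
change (ctd_fun (derctd_fun delta s) (t *: tens h a 1) +
   s *: ctd_fun (derctd_fun delta t) (tens h a 1)
   - s *: ctd_fun (derctd_fun delta t) (tens h a 1) =
   ctd_fun (derctd_fun delta s) (tens h a t)).
by rewrite addrK tensZr mulr1.
Qed.

(** * The projection rho *)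

Section Rho.
Variables (k R S : comPzRingType).
Variables (h : {rmorphism k -> R}) (f : {rmorphism R -> S}).
Variables (A : nalg k) (B : SRform h f A) (N : dimod (form_alg B)).
Local Notation AS := (bc_alg (f \o h) A).
Local Notation NS := (formS_dimod N).
Variable pi : {linear restr f NS -> N}.

(** R-linearity of pi with the scalars of R written in S, the form in which they
    occur on N_S. *)
Lemma pi_linear r (x y : NS) : pi (f r *: x + y) = r *: pi x + pi y.
Proof. exact: (linearP pi r x y). Qed.

Lemma rho_klinear (F : AS -> NS) :
  klinear (f \o h) F -> klinear h (rho pi F).
Proof.
move=> lF c x y; rewrite /rho -pi_linear; congr (pi _).
exact: (lF c (form_val x) (form_val y)).
Qed.

Context (pi_lact : forall (b : form_alg B) (m : NS),
  pi (lact NS (form_val b) m) = lact N b (pi m)).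
Context (pi_ract : forall (b : form_alg B) (m : NS),
  pi (ract NS m (form_val b)) = ract N (pi m) b).

Lemma rho_der (F : AS -> NS) : is_der (f \o h) F -> is_der h (rho pi F).
Proof.
move=> [lF mF]; split=> [|a b]; first exact: rho_klinear.
rewrite /rho -pi_lact -pi_ract -[RHS](linearD pi); congr (pi _).
exact: (mF (form_val a) (form_val b)).
Qed.

Lemma rho_ctd (F : AS -> NS) : is_ctd (f \o h) F -> is_ctd h (rho pi F).
Proof.
move=> [lF mF]; split=> [|a b]; first exact: rho_klinear.
have [m1 m2] := mF (form_val a) (form_val b).
by rewrite /rho -pi_lact -pi_ract; split; congr (pi _).
Qed.

Definition rhoD d := mk_der (rho_der (der_funP d)).
Definition rhoC chi := mk_ctd (rho_ctd (ctd_funP chi)).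

Lemma rhoD_fun d b : der_fun (rhoD d) b = pi (der_fun d (form_val b)).
Proof. by []. Qed.

Lemma rhoC_fun chi b : ctd_fun (rhoC chi) b = pi (ctd_fun chi (form_val b)).
Proof. by []. Qed.

Lemma rhoD_linear : linear rhoD.
Proof.
move=> c d d'; apply: der_ext => b.
by rewrite der_fun_lin !rhoD_fun der_fun_lin pi_linear.
Qed.

Lemma rhoC_linear r chi chi' :
  rhoC (f r *: chi + chi') = r *: rhoC chi + rhoC chi'.
Proof.
apply: ctd_ext => b.
by rewrite ctd_fun_lin !rhoC_fun ctd_fun_lin pi_linear.
Qed.

Lemma rhoC_ract chi r : rhoC (ctd_ract chi (f r)) = ctd_ract (rhoC chi) r.
Proof. by apply: ctd_ext. Qed.

Lemma rhoT_derctd (d : DerCtd (f \o h) AS NS) :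
  is_derctd (fun r => rhoC (derctd_fun d (f r))).
Proof.
have [l m] := derctd_funP d; split=> [c r r'|r r'].
  rewrite -rhoC_linear; congr rhoC.
  by rewrite -[h c *: r]/(h c * r) rmorphD rmorphM; apply: l.
by rewrite rmorphM m addrC rhoC_linear rhoC_ract addrC.
Qed.

Definition rhoT d := mk_derctd (rhoT_derctd d).

Lemma rhoT_fun d r : derctd_fun (rhoT d) r = rhoC (derctd_fun d (f r)).
Proof. by []. Qed.

Lemma rhoT_linear : linear rhoT.
Proof.
move=> c d d'; apply: derctd_ext => r b.
by rewrite derctd_fun_lin !rhoT_fun derctd_fun_lin rhoC_linear.
Qed.

(** R-linearity of pi moves it across d(r b) - r d(b). *)
Lemma eta_rhoD d : eta h (rhoD d) = rhoT (eta (f \o h) d).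
Proof.
apply: derctd_ext => r b.
rewrite rhoT_fun rhoC_fun !eta_fun !rhoD_fun.
by rewrite addrC -scaleNr -pi_linear rmorphN scaleNr addrC.
Qed.

(** On r in R and b in B, the extended derivation takes the value
    delta(r)(b) (x) 1, which pi sends back to delta(r)(b). *)
Lemma rhoT_epsN delta delta' :
  (forall n : N, pi (tens f n 1) = n) -> is_epsN delta delta' ->
  rhoT delta' = delta.
Proof.
move=> piK [D [c [[_ _ De] Hc E]]]; apply: derctd_ext => r b.
by rewrite rhoT_fun rhoC_fun E De (Hc _ _).2 scale1r piK.
Qed.

End Rho.

(** * The two rows and their sections *)

Theorem theorem2p7
  (k R S : comPzRingType) (h : {rmorphism k -> R}) (f : {rmorphism R -> S})
  (A : nalg k)
  (A_perfect : perfect A) (A_fp : fin_pres_module A)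
  (R_flat : flat h)
  (S_etale : etale f) (S_ff : faithfully_flat f)
  (B : SRform h f A)
  (N : dimod (form_alg B))
  (pi : {linear restr f (formS_dimod N) -> N})
  (pi_lact : forall (b : form_alg B) (m : formS_dimod N),
     pi (lact (formS_dimod N) (form_val b) m) = lact N b (pi m))
  (pi_ract : forall (b : form_alg B) (m : formS_dimod N),
     pi (ract (formS_dimod N) m (form_val b)) = ract N (pi m) b) :
  (* rho : Hom_k(A_S, N_S) -> Hom_k(B, N), and (a) *)
  (forall F : bc_alg (f \o h) A -> formS_dimod N,
     klinear (f \o h) F -> klinear h (rho pi F)) /\
  (forall F : bc_alg (f \o h) A -> formS_dimod N,
     is_der (f \o h) F -> is_der h (rho pi F)) /\
  (forall F : bc_alg (f \o h) A -> formS_dimod N,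
     is_ctd (f \o h) F -> is_ctd h (rho pi F)) /\
  (* the restrictions of rho to Der_k and Ctd_k, the map rho~ and epsilon_N *)
  exists
    (rhoD : {linear Der (f \o h) (bc_alg (f \o h) A) (formS_dimod N)
                    -> Der h (form_alg B) N})
    (rhoC : Ctd (f \o h) (bc_alg (f \o h) A) (formS_dimod N)
            -> Ctd h (form_alg B) N)
    (rhoT : {linear DerCtd (f \o h) (bc_alg (f \o h) A) (formS_dimod N)
                    -> DerCtd h (form_alg B) N})
    (epsN : {linear DerCtd h (form_alg B) N
                    -> DerCtd (f \o h) (bc_alg (f \o h) A) (formS_dimod N)}),
    (forall d, der_fun (rhoD d) = rho pi (der_fun d)) /\
    (forall chi, ctd_fun (rhoC chi) = rho pi (ctd_fun chi)) /\
    (* (c) *)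
    (forall d r, derctd_fun (rhoT d) r = rhoC (derctd_fun d (f r))) /\
    (forall delta delta', is_epsN delta delta' <-> delta' = epsN delta) /\
    (* (b) *)
    ({morph rhoC : chi chi' / chi + chi'} /\
     (forall r chi, rhoC (f r *: chi) = r *: rhoC chi) /\
     (forall r chi, rhoC (ctd_ract chi (f r)) = ctd_ract (rhoC chi) r)) /\
    (* (c) *)
    (forall d, eta h (rhoD (sigmaS d)) = rhoT d) /\
    (* (d), for pi a retraction of n |-> n (x) 1 *)
    ((forall n : N, pi (tens f n 1) = n) ->
       (forall delta, eta h (rhoD (sigmaS (epsN delta))) = delta) /\
       exists Phi : {linear (DerR h (form_alg B) N * DerCtd h (form_alg B) N)%type
                            -> Der h (form_alg B) N},
         (forall d delta,
            Phi (d, delta) = der_incl d + rhoD (sigmaS (epsN delta))) /\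
         bijective Phi) /\
    (* (e) *)
    (injective (@der_incl _ _ (f \o h) (bc_alg (f \o h) A) (formS_dimod N)) /\
     exact_at (@der_incl _ _ (f \o h) (bc_alg (f \o h) A) (formS_dimod N))
              (eta (f \o h)) /\
     (forall delta : DerCtd (f \o h) (bc_alg (f \o h) A) (formS_dimod N),
        exists d, eta (f \o h) d = delta) /\
     (forall delta : DerCtd (f \o h) (bc_alg (f \o h) A) (formS_dimod N),
        eta (f \o h) (sigmaS delta) = delta) /\
     injective (@der_incl _ _ h (form_alg B) N) /\
     exact_at (@der_incl _ _ h (form_alg B) N) (eta h) /\
     (forall d, eta h (rhoD d) = rhoT (eta (f \o h) d))).
Proof.
have [_ fet] := S_etale.
have Bperf : perfect (form_alg B) by exact: form_perfect.
have [epsN epsNP] := epsN_exists N A_perfect Bperf fet.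
have [rD rDE] := linear_exists (rhoD_linear pi_lact pi_ract).
have [rT rTE] := linear_exists (rhoT_linear pi_lact pi_ract).
have etaD d : eta h (rD d) = rT (eta (f \o h) d).
  by rewrite rDE rTE; apply: eta_rhoD.
have etaT d : eta h (rD (sigmaS d)) = rT d by rewrite etaD eta_sigmaS.
have rC := rhoC_linear pi_lact pi_ract.
split; first exact: rho_klinear.
split; first exact: rho_der.
split; first exact: rho_ctd.
exists rD, (rhoC pi_lact pi_ract), rT, epsN.
split; first by move=> d; rewrite rDE.
split; first by [].
split; first by move=> d r; rewrite rTE.
split; first exact: epsNP.
split.
  split; first by move=> x y; have := rC 1 x y; rewrite rmorph1 !scale1r.
  split; last by move=> r chi; apply: rhoC_ract.
  have rC0 : rhoC pi_lact pi_ract 0 = 0.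
    have := rC (-1) 0 0.
    by rewrite rmorphN rmorph1 !scaleN1r !oppr0 !addr0 addNr.
  by move=> r x; have := rC r x 0; rewrite rC0 !addr0.
split; first exact: etaT.
split.
  move=> piK.
  have sec delta : eta h (rD (sigmaS (epsN delta))) = delta.
    by rewrite etaT rTE; apply: rhoT_epsN piK _; apply/epsNP.
  split=> //.
  have [s sE] :
      exists s : {linear DerCtd h (form_alg B) N -> Der h (form_alg B) N},
      s =1 fun delta => rD (sigmaS (epsN delta)).
    by apply: linear_exists => c d d'; rewrite !linearP.
  have sK : cancel s (eta h) by move=> delta; rewrite sE.
  have [Phi [PhiE Phi_bij]] := split_exact (@der_incl_injective _ _ h _ N)
    (@eta_exact _ _ h _ N) sK.
  by exists Phi; split=> // d delta; rewrite PhiE sE.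
split; first exact: der_incl_injective.
split; first exact: eta_exact.
split; first by move=> delta; exists (sigmaS delta); apply: eta_sigmaS.
split; first exact: eta_sigmaS.
split; first exact: der_incl_injective.
by split; first exact: eta_exact.
Qed.
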